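(* Let $c>0$ and $p>1$ be constants and $a_k=\lfloor ck^p\rfloor$, $k\ge1$. Assume $\mathbb E X_i=0$, $X_i\in\mathcal L^\alpha$ for some $\alpha\in(2,4]$, and $\sum_{j=0}^\infty\delta_\alpha(j)<\infty$. Then $$\|V_n-\mathbb EV_n\|_{\alpha/2}=O\big(n^{3/2-3/(2p)+2/\alpha}\big)\qquad(n\to\infty).$$
   Context: Let $(\varepsilon_i)_{i\in\mathbb Z}$ be i.i.d. random variables, $\mathcal F_i$ the $\sigma$-field generated by $(\ldots,\varepsilon_{i-1},\varepsilon_i)$, and $X_i=g(\ldots,\varepsilon_{i-1},\varepsilon_i)$ for a measurable $g$ such that $X_i$ is well defined. $\|\xi\|_p=(\mathbb E|\xi|^p)^{1/p}$ and $\xi\in\mathcal L^p$ means $\|\xi\|_p<\infty$. Physical dependence measure: let $\varepsilon_0'$ have the law of $\varepsilon_0$ and be independent of $(\varepsilon_j)_{j\in\mathbb Z}$; for $i\ge0$ set $X_i'=g(\ldots,\varepsilon_{-1},\varepsilon_0',\varepsilon_1,\ldots,\varepsilon_i)$ and $\delta_p(i)=\|X_i-X_i'\|_p$. Given an integer sequence $(a_k)_{k\ge1}$ with $a_k\to\infty$, define for $i\ge1$: $t_i=\max(\{1\}\cup\{a_k:k\ge1,\ a_k\le i\})$, $W_i=X_{t_i}+\cdots+X_i$, $l_i=i-t_i+1$, $V_n=\sum_{i=1}^nW_i^2$, $v_n=\sum_{i=1}^nl_i$. *)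

(* Defs.v *)
From HB Require Import structures.
From mathcomp Require Import all_boot all_order all_algebra.
From mathcomp Require Import all_classical all_reals all_analysis.
Set Implicit Arguments. Unset Strict Implicit. Unset Printing Implicit Defensive.
Import Order.TTheory GRing.Theory Num.Theory.
Local Open Scope classical_set_scope.
Local Open Scope ring_scope.

Definition iid_family {d} {T : measurableType d} {R : realType}
  (P : probability T R) {dE} {E : measurableType dE} {I : eqType}
  (Y : I -> T -> E) : Prop :=
  [/\ (forall i, measurable_fun setT (Y i)),
      (forall i j (B : set E), measurable B ->
          P (Y i @^-1` B) = P (Y j @^-1` B)) &
      (forall (J : seq I) (B : I -> set E), uniq J ->
          (forall j, j \in J -> measurable (B j)) ->
          P (\big[setI/setT]_(j <- J) (Y j @^-1` B j))
          = (\prod_(j <- J) P (Y j @^-1` B j))%E)].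

Definition cyl_sets {dE} (E : measurableType dE) : set (set (nat -> E)) :=
  [set A | exists (k : nat) (B : set E), measurable B /\
                                         A = (fun f => f k) @^-1` B].

Definition prod_measurable {dE} {E : measurableType dE} {R : realType}
  (g : (nat -> E) -> R) : Prop :=
  forall B : set R, measurable B -> smallest (sigma_algebra setT) (@cyl_sets _ E) (g @^-1` B).

(* X_i = g(..., eps_{i-1}, eps_i): the argument k |-> eps_{i-k}. *)
Definition Xseq {T} {E} {R : realType} (g : (nat -> E) -> R)
  (eps : int -> T -> E) (i : int) : T -> R :=
  fun w => g (fun k : nat => eps (i - k%:Z) w).

Definition Xseq' {T} {E} {R : realType} (g : (nat -> E) -> R)
  (eps : int -> T -> E) (eps0' : T -> E) (i : int) : T -> R :=
  fun w => g (fun k : nat => if i - k%:Z == 0 then eps0' w else eps (i - k%:Z) w).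

Definition phys_dep {d} {T : measurableType d} {R : realType}
  (P : probability T R) {E} (g : (nat -> E) -> R)
  (eps : int -> T -> E) (eps0' : T -> E) (q : R) (j : nat) : \bar R :=
  Lnorm P q%:E (EFin \o (fun w => Xseq g eps j%:Z w - Xseq' g eps eps0' j%:Z w)).

Definition aseq {R : realType} (c p : R) (k : nat) : nat :=
  `|Num.floor (c * (k%:R `^ p))|%N.

Definition tset (a : nat -> nat) (i : nat) : set nat :=
  [set m | m = 1%N \/ exists k, (1 <= k)%N /\ a k = m /\ (a k <= i)%N].
Definition tseq (a : nat -> nat) (i : nat) : nat :=
  xget 1%N [set m | tset a i m /\ forall s, tset a i s -> (s <= m)%N].

Definition Wseq {T} {E} {R : realType} (g : (nat -> E) -> R)
  (eps : int -> T -> E) (a : nat -> nat) (i : nat) : T -> R :=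
  fun w => \sum_(tseq a i <= j < i.+1) Xseq g eps j%:Z w.

Definition Vseq {T} {E} {R : realType} (g : (nat -> E) -> R)
  (eps : int -> T -> E) (a : nat -> nat) (n : nat) : T -> R :=
  fun w => \sum_(1 <= i < n.+1) (Wseq g eps a i w) ^+ 2.

(* Main.v *)
(** Let [cexp k F] be the conditional expectation of [F] given the innovations
    up to time [k].  Since [V_n - E V_n] is the sum over [k <= n] of the
    martingale differences [D_k = cexp k V_n - cexp (k - 1) V_n], the von
    Bahr-Esseen inequality with [q = alpha / 2 <= 2] bounds
    [||V_n - E V_n||_q ^ q] by a multiple of the sum of the [||D_k||_q ^ q].
    Replacing the innovation at time [k] by an independent copy and factoring
    [W_i^2 - W_i'^2 = (W_i + W_i') (W_i - W_i')], one gets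
    [||D_k||_q <= 2 max_i ||W_i||_alpha * sum_(i <= n) sum_(t_i <= j <= i) delta (j - k)],
    and the same decomposition of [W_i], now with an inequality of Burkholder
    type for the exponent [alpha > 2], gives [||W_i||_alpha = O(sqrt l_i)].
    As [l_i = O(n^(1 - 1/p))], each [||D_k||_q] is [O(n^(3/2 (1 - 1/p)))] and
    their sum over [k] is at most [n] times this.

    All of this takes place on two independent copies of the path space of the
    innovations: a conditional expectation is an integral over the second copy,
    and resampling an innovation is reading it from the second copy. *)
Require Import Defs.
From HB Require Import structures.
From mathcomp Require Import all_boot all_order all_algebra.
From mathcomp Require Import all_classical all_reals all_analysis.
From mathcomp Require Import measurable_realfun.
From mathcomp Require Import zify ring lra.
Set Implicit Arguments. Unset Strict Implicit. Unset Printing Implicit Defensive.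
Import Order.TTheory GRing.Theory Num.Theory numFieldNormedType.Exports.
Local Open Scope classical_set_scope.
Local Open Scope ring_scope.

(** * Inequalities for real powers *)

Section PowerInequalities.
Context {R : realType}.
Implicit Types (x d y r : R).

(** Both moment inequalities come from pointwise expansions of [|x + d|^r]. If [x] is a sum of older
    martingale differences and [d] is the next one, the linear term integrates to zero, and an
    induction over finitely many differences remains. The differences, however, go back to time
    minus infinity, which raises two questions. First, the conditional expectation given the remote
    past must tend to the mean in norm. This property holds for indicators, is stable under linear
    combinations and survives approximation in norm, so it holds on the whole space. Second, the sum
    of the [||D_k||_q ^ q] over infinitely many [k] must still be of order [n]. If [c_k] is the
    bound found for [||D_k||_q], this sum is at most [(max c)^(q - 1)] times the sum of the [c_k].
    In the latter, a fixed index [i] and a fixed position in its block contribute at most one full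
    sum of [delta] over all [k], so only the [n] values of [i] are left to count. *)

Lemma powR_le_tangent y r : 0 <= y -> 0 < r -> r <= 1 ->
  y `^ r <= 1 + r * (y - 1).
Proof.
move=> y0 r0; rewrite le_eqVlt => /predU1P[->|r1].
  by rewrite powRr1//; lra.
(* Young's inequality for the product of [y^r] and 1, with exponents [1/r] and [1/(1 - r)]. *)
have := @conjugate_powR R (y `^ r) 1 r^-1 (1 - r)^-1 (powR_ge0 _ _) ler01.
rewrite !invr_gt0 subr_gt0 !invrK => /(_ r0 r1).
rewrite -powRrM mulfV ?gt_eqF// powRr1// powR1 mulr1.
move=> h; have /h : r + (1 - r) = 1 by lra.
by move/le_trans; apply; lra.
Qed.

(** This is the concave case at the point [y^r] with exponent [1/r], solved for [y^r]. *)
Lemma powR_ge_tangent y r : 0 <= y -> 1 <= r -> 1 + r * (y - 1) <= y `^ r.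
Proof.
move=> y0 r1; have r0 : 0 < r by lra.
have := @powR_le_tangent (y `^ r) r^-1 (powR_ge0 _ _).
rewrite invr_gt0 invf_le1// -powRrM mulfV ?gt_eqF// powRr1// => /(_ r0 r1) h.
have : r * y <= r * (1 + r^-1 * (y `^ r - 1)) by rewrite ler_pM2l.
by rewrite mulrDr mulr1 mulrA mulfV ?gt_eqF// mul1r; lra.
Qed.

(** Up to the factor [r], this is the derivative of [|x|^r]. *)
Definition sgpow r x : R := Num.sg x * `|x| `^ (r - 1).

Lemma normr_sgpow r x : 1 < r -> `|sgpow r x| = `|x| `^ (r - 1).
Proof.
move=> r1; rewrite /sgpow normrM normr_sg [X in _ * X]ger0_norm ?powR_ge0//.
by have [->|x0] := eqVneq x 0; rewrite ?mul1r// normr0 powR0 ?mulr0//; lra.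
Qed.

(* Bernoulli's inequality applied to [(1 + u)^4] and the exponent [r / 4 <= 1]. *)
Lemma powR1D_le (u : R) r : `|u| <= 1 -> 0 < r -> r <= 4 ->
  (1 + u) `^ r <= 1 + r * u + 11 * u ^+ 2.
Proof.
rewrite ler_norml => /andP[u1 u2] r0 r4.
have := @powR_le_tangent ((1 + u) `^ 4) (r / 4) (powR_ge0 _ _).
rewrite -powRrM (mulrC 4) divfK// => h.
have {h} : (1 + u) `^ r <= 1 + r / 4 * ((1 + u) `^ 4 - 1) by apply: h; lra.
move/le_trans; apply.
rewrite powR_mulrn; last lra.
rewrite -addrA lerD2l.
have -> : r / 4 * ((1 + u) ^+ 4 - 1) =
    r * u + r / 4 * (6 + u * 4 + u ^+ 2) * u ^+ 2 by field.
rewrite lerD2l; apply: ler_wpM2r; first exact: sqr_ge0.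
have : u ^+ 2 <= 1 by nra.
by nra.
Qed.

(** Writing [x + d = x (1 + d/x)] with [|d/x| <= 1] makes the second factor non-negative and reduces
    the claim to [powR1D_le]. *)
Lemma powR_normD_le_small x d r : 1 < r -> r <= 4 -> x != 0 -> `|d| <= `|x| ->
  `|x + d| `^ r <=
  `|x| `^ r + r * (sgpow r x * d) + 11 * (`|x| `^ (r - 2) * d ^+ 2).
Proof.
move=> r1 r4 x0 dx; have nx0 : 0 < `|x| by rewrite normr_gt0.
have u1 : `|d / x| <= 1 by rewrite normf_div ler_pdivrMr ?mul1r.
have -> : x + d = x * (1 + d / x) by field.
have r0 : 0 < r by lra.
have u0 : 0 <= 1 + d / x by move: u1; rewrite ler_norml; lra.
rewrite normrM (ger0_norm u0) powRM//.
have := ler_wpM2l (powR_ge0 `|x| r) (powR1D_le u1 r0 r4).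
move/le_trans; apply.
have E1 : `|x| `^ r = `|x| `^ (r - 1) * (Num.sg x * x).
  by rewrite -normrEsg mulrC mulr_powRB1.
have E2 : `|x| `^ r = `|x| `^ (r - 2) * `|x| ^+ 2.
  by rewrite -powR_mulrn// -powRD ?subrK// gt_eqF.
rewrite !mulrDr mulr1 le_eqVlt; apply/orP; left; apply/eqP; congr (_ + _ + _).
  by rewrite E1 /sgpow; field.
by rewrite E2 real_normK ?num_real//; field.
Qed.

(** Here [|d|^r] dominates everything: the left side is at most [(2|d|)^r <= 16 |d|^r], and the
    linear term is at least [-4 |d|^r]. Hence the constant 20 = 16 + 4. *)
Lemma powR_normD_le_large x d r : 1 < r -> r <= 4 -> `|x| <= `|d| ->
  `|x + d| `^ r <= `|x| `^ r + r * (sgpow r x * d) + 20 * `|d| `^ r.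
Proof.
move=> r1 r4 xd.
have h1 : `|x + d| `^ r <= 16 * `|d| `^ r.
  have -> : 16 * `|d| `^ r = 2 `^ 4 * `|d| `^ r :> R.
    by rewrite powR_mulrn//; congr (_ * _); ring.
  apply: (@le_trans _ _ ((2 * `|d|) `^ r)).
    apply: ge0_ler_powR; rewrite ?nnegrE//; first lra.
    by have := ler_normD x d; lra.
  by rewrite powRM// ler_wpM2r ?powR_ge0// ler_powR//; lra.
have h2 : - (4 * `|d| `^ r) <= r * (sgpow r x * d).
  rewrite lerNl -mulrN; apply: (le_trans (ler_norm _)).
  rewrite !normrM normrN normrM normr_sgpow// gtr0_norm; last lra.
  apply: ler_pM => //; first lra.
  rewrite -[leRHS]mulr_powRB1//; last lra.
  by rewrite mulrC ler_wpM2l// ge0_ler_powR ?nnegrE//; lra.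
by have := powR_ge0 `|x| r; lra.
Qed.

Lemma powR_normD_le12 x d r : 1 < r -> r <= 2 ->
  `|x + d| `^ r <= `|x| `^ r + r * (sgpow r x * d) + 20 * `|d| `^ r.
Proof.
move=> r1 r2; have r4 : r <= 4 by lra.
have [xd|xd] := leP `|x| `|d|; first exact: powR_normD_le_large.
have x0 : x != 0 by rewrite -normr_gt0 (le_lt_trans _ xd).
apply: (le_trans (powR_normD_le_small r1 r4 x0 (ltW xd))).
rewrite lerD2l.
(* As [r - 2 <= 0] and [|d| < |x|], replacing [|x|] by [|d|] in the quadratic term only increases
   it. *)
suff : `|x| `^ (r - 2) * d ^+ 2 <= `|d| `^ r.
  by have := powR_ge0 `|d| r; lra.
have [->|d0] := eqVneq d 0.
  by rewrite expr0n/= mulr0 powR_ge0.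
have nd0 : 0 < `|d| by rewrite normr_gt0.
have -> : `|d| `^ r = `|d| `^ (r - 2) * d ^+ 2.
  rewrite -[d ^+ 2]real_normK ?num_real// -powR_mulrn// -powRD ?subrK//.
  by apply/implyP => _; rewrite gt_eqF.
rewrite ler_wpM2r ?sqr_ge0//.
have -> : r - 2 = - (2 - r) by ring.
rewrite !powRN lef_pV2 ?posrE ?powR_gt0 ?normr_gt0//.
by rewrite ge0_ler_powR ?nnegrE ?(ltW xd)//; lra.
Qed.

Lemma powR_normD_le24 x d r : 2 < r -> r <= 4 ->
  `|x + d| `^ r <= `|x| `^ r + r * (sgpow r x * d) +
                   20 * (`|x| `^ (r - 2) * d ^+ 2 + `|d| `^ r).
Proof.
move=> r2 r4; have r1 : 1 < r by lra.
have p1 := powR_ge0 `|d| r.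
have p2 : 0 <= `|x| `^ (r - 2) * d ^+ 2 by rewrite mulr_ge0 ?powR_ge0 ?sqr_ge0.
have [xd|xd] := leP `|x| `|d|.
  by apply: (le_trans (powR_normD_le_large r1 r4 xd)); lra.
have x0 : x != 0 by rewrite -normr_gt0 (le_lt_trans _ xd).
by apply: (le_trans (powR_normD_le_small r1 r4 x0 (ltW xd))); lra.
Qed.

(* Since [b^rho <= (a + b)^rho - a^rho] and, by convexity,
   [rho a^(rho - 1) b <= (a + b)^rho - a^rho], the constant 40 suffices. *)
Lemma powRD_ge_step (a b rho : R) : 0 <= a -> 0 <= b -> 1 <= rho ->
  (40 * a) `^ rho + 20 * ((40 * a) `^ (rho - 1) * b + b `^ rho) <=
  (40 * (a + b)) `^ rho.
Proof.
move=> a0 b0 rho1.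
rewrite !powRM ?addr_ge0//.
have -> : 40 `^ rho = 40 * 40 `^ (rho - 1) :> R by rewrite mulr_powRB1//; lra.
set k := 40 `^ (rho - 1).
have k1 : 1 <= k by rewrite -[leLHS](powRr0 40) ler_powR//; lra.
have [->|an0] := eqVneq a 0.
  rewrite add0r powR0; last by rewrite gt_eqF//; lra.
  have [r1|r1] := eqVneq (rho - 1) 0.
    have -> : rho = 1 by lra.
    by rewrite /k r1 subrr !powRr0 !powRr1//; lra.
  by rewrite powR0//; have := powR_ge0 b rho; nra.
have ap : 0 < a by rewrite lt_neqAle eq_sym an0.
set A := a `^ rho; set B := b `^ rho; set A' := a `^ (rho - 1).
set S := (a + b) `^ rho.
have A'0 : 0 <= A' by exact: powR_ge0.
have B0 : 0 <= B by exact: powR_ge0.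
have AE : A = a * A' by rewrite /A mulr_powRB1//; lra.
have conv : A + A' * b <= S.
  have -> : S = A * (1 + b / a) `^ rho.
    rewrite -powRM//; last by rewrite addr_ge0// divr_ge0.
    by congr (_ `^ _); field.
  apply: (le_trans _ (ler_wpM2l (powR_ge0 _ _) (powR_ge_tangent _ rho1))).
    have -> : A * (1 + rho * (1 + b / a - 1)) = A + rho * (A' * b).
      by rewrite AE; field.
    by have : 0 <= A' * b by [rewrite mulr_ge0]; nra.
  by rewrite addr_ge0// divr_ge0.
have supadd : A + B <= S.
  rewrite /S -(@mulr_powRB1 _ (a + b)) ?addr_ge0//; last lra.
  rewrite AE /B -(@mulr_powRB1 _ b)//; last lra.
  by rewrite mulrDl; apply: lerD; apply: ler_wpM2l => //;
    apply: ge0_ler_powR; rewrite ?nnegrE//; lra.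
by nra.
Qed.
End PowerInequalities.

(** * Moments and norms *)

Section Moments.
Context {d} {T : measurableType d} {R : realType} (m : probability T R).
Implicit Types (f g S D : T -> R) (r a b : R).

(** Real-valued, with an infinite integral read as 0. For this reason the identities below ask for
    membership in [Lfun]. *)
Definition mom r f : R := \int[m]_x (`|f x| `^ r).
Definition nrm r f : R := fine ('N[m]_r%:E [EFin \o f]).

Lemma Lfun_measurable r f : f \in Lfun m r%:E -> measurable_fun setT f.
Proof. by rewrite inE => /andP[+ _]; rewrite inE. Qed.

Lemma measurable_normr_powR r f : measurable_fun setT f ->
  measurable_fun setT (fun x => `|f x| `^ r).
Proof.
by move=> mf; apply: (measurableT_comp (measurable_powR _)) => //;
  exact: measurableT_comp.
Qed.

Lemma Lfun_integrable_powR r f : 0 < r -> measurable_fun setT f ->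
  f \in Lfun m r%:E <-> m.-integrable setT (EFin \o (fun x => `|f x| `^ r)).
Proof.
move=> r0 mf; have rn0 : r != 0 by rewrite gt_eqF.
have mfr : measurable_fun setT (EFin \o (fun x => `|f x| `^ r)).
  by apply/measurable_EFinP; exact: measurable_normr_powR.
have E : (\int[m]_x `|(EFin \o (fun x => (`|f x| `^ r)%R)) x| =
          'N[m]_r%:E [EFin \o f] `^ r)%E.
  rewrite powR_Lnorm//; apply: eq_integral => x _ /=.
  by rewrite ger0_norm// powR_ge0.
split.
  rewrite inE => /andP[_]; rewrite inE/= /finite_norm => lf.
  by apply/integrableP; split => //; rewrite E poweR_lty.
move=> /integrableP[_]; rewrite E => /(@lty_poweRy _ _ _ rn0) lf.
by rewrite inE; apply/andP; split; rewrite inE.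
Qed.

Lemma Lfun_Lnorm r f : f \in Lfun m r%:E -> ('N[m]_r%:E [EFin \o f] < +oo)%E.
Proof. by rewrite inE => /andP[_]; rewrite inE. Qed.

Lemma nrmE r f : f \in Lfun m r%:E -> (nrm r f)%:E = ('N[m]_r%:E [EFin \o f])%E.
Proof.
by move=> /Lfun_Lnorm lf; rewrite /nrm fineK// ge0_fin_numE// Lnorm_ge0.
Qed.

Lemma nrm_ge0 r f : 0 <= nrm r f.
Proof. by rewrite /nrm fine_ge0// Lnorm_ge0. Qed.

Lemma mom_ge0 r f : 0 <= mom r f.
Proof. by apply: Rintegral_ge0 => x _; exact: powR_ge0. Qed.

Lemma momE r f : 0 < r -> f \in Lfun m r%:E ->
  (mom r f)%:E = (\int[m]_x (`|f x| `^ r)%:E)%E.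
Proof.
move=> r0 lf; rewrite /mom /Rintegral fineK//.
apply: integrable_fin_num => //.
exact: (Lfun_integrable_powR r0 (Lfun_measurable lf)).1.
Qed.

Lemma nrm_mom r f : 0 < r -> f \in Lfun m r%:E -> nrm r f = mom r f `^ r^-1.
Proof.
move=> r0 lf; apply: EFin_inj; rewrite nrmE// -poweR_EFin momE//.
by rewrite unlock.
Qed.

Lemma mom_nrm r f : 0 < r -> f \in Lfun m r%:E -> mom r f = nrm r f `^ r.
Proof.
by move=> r0 lf; rewrite nrm_mom// -powRrM mulVf ?gt_eqF// powRr1// mom_ge0.
Qed.

Lemma LfunD r f g : 1 <= r -> f \in Lfun m r%:E -> g \in Lfun m r%:E ->
  (fun x => f x + g x) \in Lfun m r%:E.
Proof.
move=> r1; have r1' : (1 <= r%:E)%E by rewrite lee_fin.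
by move=> *; apply: (Lfun_addr_closed m r1').2.
Qed.

Lemma LfunN r f : 1 <= r -> f \in Lfun m r%:E -> (fun x => - f x) \in Lfun m r%:E.
Proof.
move=> r1; have r1' : (1 <= r%:E)%E by rewrite lee_fin.
by move=> lf; exact: (@Lfun_oppr_closed _ _ _ m _ f lf).
Qed.

Lemma LfunB r f g : 1 <= r -> f \in Lfun m r%:E -> g \in Lfun m r%:E ->
  (fun x => f x - g x) \in Lfun m r%:E.
Proof. by move=> r1 lf lg; apply: LfunD => //; exact: LfunN. Qed.

Lemma Lfun0 r : (fun=> 0) \in Lfun m r%:E.
Proof. exact: Lfun_cst. Qed.

Lemma Lfun_sum {I} (s : seq I) (P : pred I) r (f : I -> T -> R) : 1 <= r ->
  (forall i, P i -> f i \in Lfun m r%:E) ->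
  (fun x => \sum_(i <- s | P i) f i x) \in Lfun m r%:E.
Proof.
move=> r1 lf; elim: s => [|i s IH].
  by rewrite (_ : (fun x => _) = fun=> 0) ?Lfun0//; apply/funext => x; rewrite big_nil.
rewrite (_ : (fun x => _) = fun x => (if P i then f i x + \sum_(j <- s | P j) f j x
    else \sum_(j <- s | P j) f j x)); last by apply/funext => x; rewrite big_cons.
by case Pi: (P i) => //; apply: LfunD => //; exact: lf.
Qed.

Lemma Lfun_le r f g : 1 <= r -> measurable_fun setT f ->
  (forall x, `|f x| <= `|g x|) -> g \in Lfun m r%:E -> f \in Lfun m r%:E.
Proof.
move=> r1 mf fg lg; have r0 : 0 < r by lra.
apply/Lfun_integrable_powR => //.
apply: (le_integrable _ _ _ ((Lfun_integrable_powR r0 (Lfun_measurable lg)).1 lg)) => //.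
  by apply/measurable_EFinP; exact: measurable_normr_powR.
move=> x _ /=; rewrite lee_fin !(ger0_norm (powR_ge0 _ _)).
by apply: ge0_ler_powR; rewrite ?nnegrE ?fg//; lra.
Qed.

Lemma Lfun_sub r a f : 1 <= a -> a <= r -> f \in Lfun m r%:E -> f \in Lfun m a%:E.
Proof.
move=> a1 ar; apply: Lfun_subset; rewrite ?lee_fin//.
  exact: le_trans ar.
by rewrite fin_num_measure.
Qed.

Lemma Lfun_L1 r f : 1 <= r -> f \in Lfun m r%:E -> m.-integrable setT (EFin \o f).
Proof. by move=> r1 /(Lfun_sub (lexx _) r1) /Lfun1_integrable. Qed.

Lemma nrmD r f g : 1 <= r -> f \in Lfun m r%:E -> g \in Lfun m r%:E ->
  nrm r (fun x => f x + g x) <= nrm r f + nrm r g.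
Proof.
move=> r1 lf lg; rewrite -lee_fin EFinD (nrmE lf) (nrmE lg) (nrmE (LfunD r1 lf lg)).
by apply: minkowski => //; [exact: Lfun_measurable lf|exact: Lfun_measurable lg].
Qed.

Lemma Rintegral_cst1 (c : R) : \int[m]_x c = c.
Proof.
rewrite Rintegral_cst// (_ : fine (m setT) = 1) ?mulr1//.
by have -> : m setT = 1%E by exact: probability_setT.
Qed.

Lemma nrm0 r : 0 < r -> nrm r (fun=> 0) = 0.
Proof.
by move=> r0; rewrite nrm_mom ?Lfun0// /mom; under eq_Rintegral do
  rewrite normr0 powR0 ?gt_eqF//; rewrite Rintegral_cst1 powR0// invr_eq0 gt_eqF.
Qed.

Lemma nrm_sum {I} (s : seq I) (P : pred I) r (f : I -> T -> R) : 1 <= r ->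
  (forall i, P i -> f i \in Lfun m r%:E) ->
  nrm r (fun x => \sum_(i <- s | P i) f i x) <= \sum_(i <- s | P i) nrm r (f i).
Proof.
move=> r1 lf; elim: s => [|i s IH].
  rewrite (_ : (fun x => _) = fun=> 0); last by apply/funext => x; rewrite big_nil.
  by rewrite big_nil nrm0//; lra.
rewrite big_cons (_ : (fun x => _) = fun x => (if P i
    then f i x + \sum_(j <- s | P j) f j x else \sum_(j <- s | P j) f j x)); last by apply/funext => x; rewrite big_cons.
case Pi: (P i) => //; apply: (le_trans (nrmD _ _ _)) => //; first exact: lf.
  exact: Lfun_sum.
by rewrite lerD2l.
Qed.

(** Hölder's inequality with the conjugate exponents [r/a] and [r/b]; integrability follows from the
    finiteness of the bound. *)
Lemma hoelder_mom a b r f g : 0 < a -> 0 < b -> a + b = r -> 1 <= r ->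
  f \in Lfun m r%:E -> g \in Lfun m r%:E ->
  m.-integrable setT (EFin \o (fun x => `|f x| `^ a * `|g x| `^ b)) /\
  \int[m]_x (`|f x| `^ a * `|g x| `^ b) <= mom r f `^ (a / r) * mom r g `^ (b / r).
Proof.
move=> a0 b0 abr r1 lf lg; have r0 : 0 < r by lra.
have mf := measurable_normr_powR a (Lfun_measurable lf).
have mg := measurable_normr_powR b (Lfun_measurable lg).
have mfg : measurable_fun setT (fun x => `|f x| `^ a * `|g x| `^ b).
  exact: measurable_funM.
have N h c : 0 < c -> h \in Lfun m r%:E ->
    ('N[m]_(r / c)%:E [EFin \o (fun x => (`|h x| `^ c)%R)] = (mom r h `^ (c / r))%:E)%E.
  move=> c0 lh; rewrite Lnorm.unlock; set J := (X in (X `^ _)%E).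
  have -> : J = (mom r h)%:E.
    rewrite (momE r0 lh); apply: eq_integral => x _ /=.
    rewrite (ger0_norm (powR_ge0 _ _)) -powRrM; congr (_ `^ _)%:E.
    by field; rewrite gt_eqF.
  by rewrite poweR_EFin invf_div.
have := @hoelder _ _ _ m _ _ (r / a) (r / b) mf mg.
rewrite !divr_gt0// !invf_div => /(_ isT isT).
rewrite -mulrDl abr divff ?gt_eqF// => /(_ erefl).
rewrite Lnorm1 !N// => H.
have E : (\int[m]_x `|(EFin \o ((fun x => `|f x| `^ a) \* (fun x => `|g x| `^ b))%R) x| =
   \int[m]_x (`|f x| `^ a * `|g x| `^ b)%:E)%E.
  by apply: eq_integral => x _ /=; rewrite ger0_norm// mulr_ge0 ?powR_ge0.
rewrite E in H.
have I : m.-integrable setT (EFin \o (fun x => `|f x| `^ a * `|g x| `^ b)).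
  apply/integrableP; split; first exact/measurable_EFinP.
  under eq_integral => x _ do rewrite /= ger0_norm ?mulr_ge0 ?powR_ge0//.
  by apply: (le_lt_trans H); rewrite -EFinM ltry.
split => //.
rewrite -lee_fin EFinM /Rintegral fineK//.
exact: (integrable_fin_num _ I).
Qed.

Lemma nrm_mul r f g : 1 <= r -> f \in Lfun m (2 * r)%:E -> g \in Lfun m (2 * r)%:E ->
  (fun x => f x * g x) \in Lfun m r%:E /\
  nrm r (fun x => f x * g x) <= nrm (2 * r) f * nrm (2 * r) g.
Proof.
move=> r1 lf lg; have r0 : 0 < r by lra.
have r20 : 0 < 2 * r by lra.
have rr2 : r + r = 2 * r by ring.
have r21 : 1 <= 2 * r by lra.
have [] := hoelder_mom r0 r0 rr2 r21 lf lg.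
under eq_fun do rewrite -powRM// -normrM.
move=> I le.
have mfg : measurable_fun setT (fun x => f x * g x).
  by apply: measurable_funM; [exact: Lfun_measurable lf|exact: Lfun_measurable lg].
have L : (fun x => f x * g x) \in Lfun m r%:E by apply/Lfun_integrable_powR.
split => //.
rewrite (nrm_mom r0 L) (nrm_mom r20 lf) (nrm_mom r20 lg).
move: (mom_ge0 (2 * r) f) (mom_ge0 (2 * r) g) (mom_ge0 r (fun x => f x * g x)) le.
rewrite -/(mom r _) => {L lf lg I mfg}; move: (mom _ _) (mom _ _) (mom _ _) => A B C A0 B0 C0 le.
have -> : (2 * r)^-1 = r / (2 * r) * r^-1 by field; rewrite gt_eqF.
rewrite !(powRrM _ (r / (2 * r))) -powRM ?powR_ge0//.
by apply: ge0_ler_powR; rewrite ?nnegrE ?mulr_ge0 ?powR_ge0 ?invr_ge0//; exact: ltW.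
Qed.

(** Hölder's inequality against the constant 1. The statement is extended-valued and assumes no
    integrability because it is applied to sections, some of which may have an infinite moment. *)
Lemma jensen_powR r f : 1 < r -> measurable_fun setT f ->
  ((`|\int[m]_x f x| `^ r)%:E <= \int[m]_x (`|f x| `^ r)%:E)%E.
Proof.
move=> r1 mf; have r0 : 0 < r by lra.
have [fin|] := boolP (\int[m]_x (`|f x| `^ r)%:E < +oo)%E; last first.
  by rewrite ltey negbK => /eqP ->; rewrite leey.
have lf : f \in Lfun m r%:E.
  apply/Lfun_integrable_powR => //; apply/integrableP; split.
    by apply/measurable_EFinP; exact: measurable_normr_powR.
  by under eq_integral => x _ do rewrite /= ger0_norm ?powR_ge0//.
rewrite -momE// lee_fin.
have L1 : (fun=> 1) \in Lfun m r%:E by exact: Lfun_cst.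
have r10 : 0 < r - 1 by lra.
have [I H] := hoelder_mom ltr01 r10 (subrKC 1 r) (ltW r1) lf L1.
have M1 : mom r (fun=> 1) = 1.
  rewrite /mom; under eq_Rintegral do rewrite normr1 powR1.
  exact: Rintegral_cst1.
have If := Lfun_L1 (ltW r1) lf.
have A : `|\int[m]_x f x| <= mom r f `^ (1 / r).
  apply: (le_trans (le_normr_Rintegral _ If)) => //.
  move: H; rewrite M1 powR1 mulr1; apply: le_trans.
  rewrite le_eqVlt; apply/orP; left; apply/eqP.
  by apply: eq_Rintegral => x _; rewrite normr1 powR1 powRr1// mulr1.
rewrite -[leRHS]powRr1 ?mom_ge0//.
have -> : 1 = 1 / r * r by field; rewrite gt_eqF.
rewrite [leRHS]powRrM; apply: ge0_ler_powR; rewrite ?nnegrE ?powR_ge0//.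
exact: ltW.
Qed.

Lemma measurable_sgpow r f : measurable_fun setT f ->
  measurable_fun setT (fun x => sgpow r (f x)).
Proof.
move=> mf; rewrite /sgpow; apply: measurable_funM; last exact: measurable_normr_powR.
rewrite (_ : (fun x => _) = fun x => (if 0 < f x then 1 else if f x < 0 then -1 else 0)).
  apply: measurable_fun_ifT => //; first exact: measurable_fun_ltr.
  by apply: measurable_fun_ifT => //; exact: measurable_fun_ltr.
apply/funext => x; case: (ltgtP (f x) 0) => [/ltr0_sg|/gtr0_sg|->] //.
by rewrite sgr0.
Qed.

Lemma integrable_sgpowM r f g : 1 < r -> f \in Lfun m r%:E -> g \in Lfun m r%:E ->
  m.-integrable setT (EFin \o (fun x => sgpow r (f x) * g x)).
Proof.
move=> r1 lf lg; have r10 : 0 < r - 1 by lra.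
have [I _] := hoelder_mom r10 ltr01 (subrK 1 r) (ltW r1) lf lg.
apply: (le_integrable _ _ _ I) => //.
  apply/measurable_EFinP/measurable_funM; last exact: Lfun_measurable lg.
  exact/measurable_sgpow/(Lfun_measurable lf).
move=> x _ /=; rewrite lee_fin normrM normr_sgpow// powRr1//.
by rewrite [leRHS]ger0_norm// mulr_ge0// powR_ge0.
Qed.

(** One step of the von Bahr-Esseen induction: the pointwise expansion is integrated, and the
    orthogonality hypothesis removes its linear term. *)
Lemma mom_step12 r S D : 1 < r -> r <= 2 -> S \in Lfun m r%:E -> D \in Lfun m r%:E ->
  \int[m]_x (sgpow r (S x) * D x) = 0 ->
  mom r (fun x => S x + D x) <= mom r S + 20 * mom r D.
Proof.
move=> r1 r2 lS lD SD0; have r0 : 0 < r by lra.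
have iSD := integrable_sgpowM r1 lS lD.
have IS := (Lfun_integrable_powR r0 (Lfun_measurable lS)).1 lS.
have ID := (Lfun_integrable_powR r0 (Lfun_measurable lD)).1 lD.
have lSD := LfunD (ltW r1) lS lD.
have ISD := (Lfun_integrable_powR r0 (Lfun_measurable lSD)).1 lSD.
have I1 : m.-integrable setT (EFin \o (fun x => r * (sgpow r (S x) * D x))).
  exact: (integrableZl measurableT r iSD).
have I2 : m.-integrable setT (EFin \o (fun x => 20 * `|D x| `^ r)).
  exact: (integrableZl measurableT 20 ID).
have I3 : m.-integrable setT
    (EFin \o (fun x => `|S x| `^ r + r * (sgpow r (S x) * D x))).
  exact: (integrableD measurableT IS I1).
apply: (@le_trans _ _ (\int[m]_x (`|S x| `^ r + r * (sgpow r (S x) * D x) +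
    20 * `|D x| `^ r))).
  apply: le_Rintegral => //; first exact: (integrableD measurableT I3 I2).
  by move=> x _; exact: powR_normD_le12.
rewrite RintegralD// RintegralD// RintegralZl// RintegralZl//.
by rewrite SD0 mulr0 addr0.
Qed.

(** One step of the Burkholder-type induction. The numbers [40 * a] and [b] bound squared norms of
    [S] and [D]; Hölder's inequality controls the mixed term, and [powRD_ge_step] absorbs the errors
    into [a + b] without changing the constant 40. *)
Lemma mom_step24 r S D (a b : R) : 2 < r -> r <= 4 -> S \in Lfun m r%:E ->
  D \in Lfun m r%:E -> \int[m]_x (sgpow r (S x) * D x) = 0 ->
  0 <= a -> 0 <= b -> mom r S <= (40 * a) `^ (r / 2) -> mom r D <= b `^ (r / 2) ->
  mom r (fun x => S x + D x) <= (40 * (a + b)) `^ (r / 2).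
Proof.
move=> r2 r4; have r0 : 0 < r by lra.
have r1 : 1 < r by lra.
have r20 : 0 < r - 2 by lra.
have rho1 : 1 <= r / 2 by lra.
move=> lS lD SD0 a0 b0 Sa Db.
have iSD := integrable_sgpowM r1 lS lD.
have IS := (Lfun_integrable_powR r0 (Lfun_measurable lS)).1 lS.
have ID := (Lfun_integrable_powR r0 (Lfun_measurable lD)).1 lD.
have lSD := LfunD (ltW r1) lS lD.
have ISD := (Lfun_integrable_powR r0 (Lfun_measurable lSD)).1 lSD.
have I1 : m.-integrable setT (EFin \o (fun x => r * (sgpow r (S x) * D x))).
  exact: (integrableZl measurableT r iSD).
have two0 : 0 < 2 :> R by [].
have [] := hoelder_mom r20 two0 (subrK 2 r) (ltW r1) lS lD.
have -> : (fun x => `|S x| `^ (r - 2) * `|D x| `^ 2) =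
          (fun x => `|S x| `^ (r - 2) * D x ^+ 2).
  by apply/funext => x; rewrite powR_mulrn// real_normK ?num_real.
move=> I0 H0.
have I4 : m.-integrable setT
    (EFin \o (fun x => `|S x| `^ (r - 2) * D x ^+ 2 + `|D x| `^ r)).
  exact: (integrableD measurableT I0 ID).
have I2 : m.-integrable setT
    (EFin \o (fun x => 20 * (`|S x| `^ (r - 2) * D x ^+ 2 + `|D x| `^ r))).
  exact: (integrableZl measurableT 20 I4).
have I3 : m.-integrable setT
    (EFin \o (fun x => `|S x| `^ r + r * (sgpow r (S x) * D x))).
  exact: (integrableD measurableT IS I1).
apply: (@le_trans _ _ (\int[m]_x (`|S x| `^ r + r * (sgpow r (S x) * D x) +
    20 * (`|S x| `^ (r - 2) * D x ^+ 2 + `|D x| `^ r)))).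
  apply: le_Rintegral => //; first exact: (integrableD measurableT I3 I2).
  by move=> x _; exact: powR_normD_le24.
rewrite RintegralD// RintegralD// RintegralZl// RintegralZl// RintegralD//.
rewrite SD0 mulr0 addr0.
apply: le_trans (powRD_ge_step a0 b0 rho1).
rewrite lerD// ler_wpM2l// lerD//.
apply: (le_trans H0).
have -> : (40 * a) `^ (r / 2 - 1) = ((40 * a) `^ (r / 2)) `^ ((r - 2) / r).
  by rewrite -powRrM; congr (_ `^ _); field; rewrite gt_eqF.
have bE : b = (b `^ (r / 2)) `^ (2 / r).
  rewrite -powRrM (_ : r / 2 * (2 / r) = 1) ?powRr1//.
  by field; rewrite gt_eqF.
rewrite [X in _ <= _ * X]bE.
have e1 : 0 <= (r - 2) / r by rewrite divr_ge0 ?ltW.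
have e2 : 0 <= 2 / r by rewrite divr_ge0 ?ltW.
apply: ler_pM; rewrite ?powR_ge0//; apply: ge0_ler_powR;
  by rewrite ?nnegrE ?mom_ge0 ?powR_ge0.
Qed.

End Moments.

(** * Measure-preserving maps and partial integrals *)

Section MeasurePreserving.
Context {d1 d2} {T1 : measurableType d1} {T2 : measurableType d2} {R : realType}.
Variables (m1 : probability T1 R) (m2 : probability T2 R).
Implicit Types (phi : T1 -> T2).

Definition mpres phi := measurable_fun setT phi /\
  forall A, measurable A -> m1 (phi @^-1` A) = m2 A.

Variables (phi : T1 -> T2) (mp : mpres phi).

Lemma mpres_measurable d {T : measurableType d} (f : T2 -> T) :
  measurable_fun setT f -> measurable_fun setT (fun x => f (phi x)).
Proof. by move=> mf; exact: (measurableT_comp mf mp.1). Qed.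

Lemma ge0_integral_mpres (f : T2 -> \bar R) : measurable_fun setT f ->
  (forall x, 0 <= f x)%E -> (\int[m1]_x f (phi x) = \int[m2]_x f x)%E.
Proof.
move=> mf f0.
rewrite -(@ge0_integral_pushforward _ _ _ _ _ phi mp.1 m1 setT f)//.
apply: eq_measure_integral; first exact: mp.1.
by move=> mphi A mA _; exact: (mp.2 A mA).
Qed.

Lemma integral_mpres (f : T2 -> \bar R) : measurable_fun setT f ->
  (\int[m1]_x f (phi x) = \int[m2]_x f x)%E.
Proof.
move=> mf; rewrite integralE [RHS]integralE; congr (_ - _)%E.
  rewrite -(@ge0_integral_mpres f^\+%E); [|exact: measurable_funepos|by []].
  by apply: eq_integral => x _; rewrite -[RHS]/((f^\+ \o phi)%E x) -funepos_comp.
rewrite -(@ge0_integral_mpres f^\-%E); [|exact: measurable_funeneg|by []].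
by apply: eq_integral => x _; rewrite -[RHS]/((f^\- \o phi)%E x) -funeneg_comp.
Qed.

Lemma Rintegral_mpres (f : T2 -> R) : measurable_fun setT f ->
  \int[m1]_x f (phi x) = \int[m2]_x f x.
Proof.
move=> mf; rewrite /Rintegral; congr fine.
by rewrite -[RHS]integral_mpres//; exact/measurable_EFinP.
Qed.

Lemma integrable_mpres (f : T2 -> R) : m2.-integrable setT (EFin \o f) ->
  m1.-integrable setT (EFin \o (fun x => f (phi x))).
Proof.
move=> /integrableP[/measurable_EFinP mf fi]; apply/integrableP; split.
  exact/measurable_EFinP/mpres_measurable.
by rewrite (ge0_integral_mpres (f := fun x => `|(f x)%:E|%E))//;
  apply: measurableT_comp => //; exact/measurable_EFinP.
Qed.

Lemma Lfun_mpres (r : R) (f : T2 -> R) : 0 < r -> f \in Lfun m2 r%:E ->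
  (fun x => f (phi x)) \in Lfun m1 r%:E.
Proof.
move=> r0 lf; have mf := Lfun_measurable lf.
apply/(Lfun_integrable_powR m1 r0 (mpres_measurable mf)).
exact: (@integrable_mpres (fun x => `|f x| `^ r)) ((Lfun_integrable_powR m2 r0 mf).1 lf).
Qed.

Lemma Lnorm_mpres r (f : T2 -> R) : measurable_fun setT f ->
  ('N[m1]_r%:E [EFin \o (fun x => f (phi x))] = 'N[m2]_r%:E [EFin \o f])%E.
Proof.
move=> mf; rewrite Lnorm.unlock; congr (_ `^ _)%E.
rewrite -(@ge0_integral_mpres (fun x => (`|f x| `^ r)%:E))//.
exact/measurable_EFinP/measurable_normr_powR.
Qed.

Lemma nrm_mpres r (f : T2 -> R) : measurable_fun setT f ->
  nrm m1 r (fun x => f (phi x)) = nrm m2 r f.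
Proof. by move=> mf; rewrite /nrm Lnorm_mpres. Qed.

End MeasurePreserving.

Section PartialIntegral.
Context {d1 d2} {T1 : measurableType d1} {T2 : measurableType d2} {R : realType}.
Variables (m1 : probability T1 R) (m2 : probability T2 R).
Implicit Types (G : T1 * T2 -> R) (h : T1 -> R).

Definition avg G (x : T1) : R := \int[m2]_y G (x, y).

Lemma mpres_snd : mpres (m1 \x m2)%E m2 snd.
Proof.
split => // A mA; have -> : snd @^-1` A = [set: T1] `*` A.
  by apply/seteqP; split => x //= [].
rewrite /= product_measure1E//.
by rewrite [X in (X * _)%E](_ : _ = 1%E) ?mul1e//; exact: probability_setT.
Qed.

Lemma measurable_section G x : measurable_fun setT G ->
  measurable_fun setT (fun y => G (x, y)).
Proof. exact: measurable_fun_pair2. Qed.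

Lemma measurable_avg G : (m1 \x m2)%E.-integrable setT (EFin \o G) ->
  measurable_fun setT (avg G).
Proof. by move=> iG; apply: measurableT_comp => //; exact: measurable_fubini_F iG. Qed.

Lemma Lfun_avg r G : 1 < r -> G \in Lfun (m1 \x m2)%E r%:E ->
  avg G \in Lfun m1 r%:E /\ mom m1 r (avg G) <= mom (m1 \x m2)%E r G.
Proof.
move=> r1; have r0 : 0 < r by lra.
move=> lG; have mG := Lfun_measurable lG.
have mA : measurable_fun setT (avg G) by exact: measurable_avg (Lfun_L1 (ltW r1) lG).
have mGr : measurable_fun setT (fun z => (`|G z| `^ r)%:E).
  exact/measurable_EFinP/measurable_normr_powR.
have Gr0 z : (0 <= (`|G z| `^ r)%:E)%E by rewrite lee_fin powR_ge0.
have le : (\int[m1]_x (`|avg G x| `^ r)%:E <= \int[(m1 \x m2)%E]_z (`|G z| `^ r)%:E)%E.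
  rewrite (fubini_tonelli1 (fun z => (`|G z| `^ r)%:E))//.
  apply: ge0_le_integral => //.
  - exact/measurable_EFinP/measurable_normr_powR.
  - exact: measurable_fun_fubini_tonelli_F.
  - by move=> x _; apply: jensen_powR => //; exact: measurable_section.
have lA : avg G \in Lfun m1 r%:E.
  apply/(Lfun_integrable_powR m1 r0 mA); apply/integrableP; split.
    exact/measurable_EFinP/measurable_normr_powR.
  under eq_integral => x _ do rewrite /= (ger0_norm (powR_ge0 _ _)).
  by apply: (le_lt_trans le); rewrite -momE// ltry.
by split => //; rewrite -lee_fin (momE r0 lA) (momE r0 lG).
Qed.

Lemma avgB_ae G1 G2 : (m1 \x m2)%E.-integrable setT (EFin \o G1) ->
  (m1 \x m2)%E.-integrable setT (EFin \o G2) ->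
  {ae m1, forall x, avg (fun z => G1 z - G2 z) x = avg G1 x - avg G2 x}.
Proof.
move=> /ae_integrable1 i1 /ae_integrable1 i2.
by apply: filterS2 i1 i2 => x i1 i2; rewrite /avg RintegralB.
Qed.

Lemma Rintegral_avgM h G : measurable_fun setT h ->
  (m1 \x m2)%E.-integrable setT (EFin \o G) ->
  (m1 \x m2)%E.-integrable setT (EFin \o (fun z => h z.1 * G z)) ->
  \int[m1]_x (h x * avg G x) = \int[(m1 \x m2)%E]_z (h z.1 * G z).
Proof.
move=> mh iG ihG; rewrite /Rintegral -integral12_prod_meas1//; congr fine.
have mA := measurable_avg iG.
apply: ae_eq_integral => //.
- exact/measurable_EFinP/measurable_funM.
- exact: measurable_fubini_F ihG.
have := ae_integrable1 iG; apply: filterS => x ix _.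
rewrite /fubini_F /avg /= -RintegralZl// /Rintegral fineK//.
by apply: integrable_fin_num => //; exact: (integrableZl measurableT (h x) ix).
Qed.

Lemma mom_ae r (f g : T1 -> R) : measurable_fun setT f -> measurable_fun setT g ->
  {ae m1, forall x, f x = g x} -> mom m1 r f = mom m1 r g.
Proof.
move=> mf mg fg; rewrite /mom /Rintegral; congr fine.
apply: ae_eq_integral => //; try exact/measurable_EFinP/measurable_normr_powR.
by apply: filterS fg => x fg _; rewrite fg.
Qed.

End PartialIntegral.

(** * Spaces of sequences *)

Section SequenceSpace.
Context (I : eqType) {dE} (E : measurableType dE).

Definition coord_sets : set (set (I -> E)) :=
  [set A | exists (k : I) (B : set E), measurable B /\
                                       A = (fun f => f k) @^-1` B].

(** For [I = nat] this is the sigma-algebra in [prod_measurable], so [g] becomes an ordinary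
    measurable function on it. *)
Definition seqspace := g_sigma_algebraType coord_sets.

Definition cyl (J : seq I) (B : I -> set E) : set seqspace :=
  [set w | forall j, j \in J -> B j (w j)].

Lemma measurable_coord i : measurable_fun setT (fun w : seqspace => w i).
Proof.
by move=> _ B mB; rewrite setTI; apply: sub_sigma_algebra; exists i, B.
Qed.

Lemma measurable_to_seqspace d (T : measurableType d) (f : T -> seqspace) :
  (forall i, measurable_fun setT (fun x => f x i)) -> measurable_fun setT f.
Proof.
move=> mf; apply: (@measurability _ _ T seqspace setT f coord_sets) => //.
by move=> _ [_ [i [B [mB ->]]] <-]; exact: mf.
Qed.

Lemma cylE J B : cyl J B = \big[setI/setT]_(j <- J) ((fun w : seqspace => w j) @^-1` B j).
Proof.
elim: J => [|j J IH]; first by rewrite big_nil; apply/seteqP; split.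
rewrite big_cons -IH; apply/seteqP; split => w /=.
  by move=> H; split=> [|i iJ]; apply: H; rewrite inE ?eqxx// iJ orbT.
by move=> [Bj H] i; rewrite inE => /predU1P[->//|]; exact: H.
Qed.

Lemma measurable_cyl J B : (forall j, measurable (B j)) -> measurable (cyl J B).
Proof.
move=> mB; rewrite cylE; elim: J => [|j J IH]; first by rewrite big_nil.
rewrite big_cons; apply: measurableI => //.
by rewrite -[X in measurable X]setTI; exact: measurable_coord.
Qed.

Context {R : realType}.

(** Cylinders generate the sigma-algebra and are stable under intersection. To intersect two of
    them, their index lists are merged without repetition, since only lists with distinct entries
    are covered by the hypothesis. *)
Lemma seqspace_measure_unique (m1 m2 : probability seqspace R) :
  (forall J B, uniq J -> (forall j, measurable (B j)) -> m1 (cyl J B) = m2 (cyl J B)) ->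
  forall A, measurable A -> m1 A = m2 A.
Proof.
move=> m12 A mA.
pose G : set (set seqspace) := [set C | exists J B, [/\ uniq J,
  (forall j, measurable (B j)) & C = cyl J B]].
have cT : setT = cyl [::] (fun=> setT) by apply/seteqP; split.
have GT : G setT by exists [::], (fun=> setT).
apply: (@g_sigma_algebra_measure_unique _ R seqspace G _ (fun=> setT)) => //.
- by move=> _ [J [B [_ mB ->]]]; exact: measurable_cyl.
- by apply/seteqP; split => // x _; exists 0%N.
- move=> _ _ [J1 [B1 [u1 mB1 ->]]] [J2 [B2 [u2 mB2 ->]]].
  exists (undup (J1 ++ J2)), (fun j => (if j \in J1 then B1 j else setT) `&`
                                       (if j \in J2 then B2 j else setT)).
  split; first exact: undup_uniq.
    by move=> j; apply: measurableI; case: ifP.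
  apply/seteqP; split => w /=.
    move=> [H1 H2] j _; split; case: ifP => // ?; [exact: H1|exact: H2].
  move=> H; split=> j jJ; have := H j; rewrite mem_undup mem_cat jJ ?orbT.
    by move=> /(_ isT)[].
  by move=> /(_ isT)[].
- by move=> _ [J [B [uJ mB ->]]]; exact: m12.
- by move=> _; rewrite (le_lt_trans (probability_le1 _ _)) ?ltry.
apply: (@smallest_sub _ _ _ _ _ _ A mA); first exact: smallest_sigma_algebra.
move=> _ [i [B [mB ->]]]; apply: sub_sigma_algebra.
exists [:: i], (fun=> B); split => //.
apply/seteqP; split => w /=; first by move=> Bw j; rewrite inE => /eqP ->.
by apply; rewrite inE.
Qed.

Lemma mpres_seqspace d (T : measurableType d) (P : probability T R)
  (m : probability seqspace R) (f : T -> seqspace) :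
  (forall i, measurable_fun setT (fun x => f x i)) ->
  (forall J B, uniq J -> (forall j, measurable (B j)) ->
     P (f @^-1` cyl J B) = m (cyl J B)) ->
  mpres P m f.
Proof.
move=> mf H; have mf' := measurable_to_seqspace mf.
split => // A mA.
pose F : {mfun T >-> seqspace} := HB.pack f (isMeasurableFun.Build _ _ _ _ f mf').
exact: (@seqspace_measure_unique (distribution P F) m H A mA).
Qed.

Definition indep_coord (m : probability seqspace R) :=
  forall J B, uniq J -> (forall j, measurable (B j)) ->
    m (cyl J B) = (\prod_(j <- J) m ((fun w : seqspace => w j) @^-1` B j))%E.

Lemma indep_coord_map (m : probability seqspace R) (K : eqType) (c : K -> I)
    (s : seq K) (B : K -> set E) : indep_coord m -> uniq s ->
  {in s &, injective c} -> (forall k, measurable (B k)) ->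
  m [set w | forall k, k \in s -> B k (w (c k))] =
  (\prod_(k <- s) m ((fun w : seqspace => w (c k)) @^-1` B k))%E.
Proof.
move=> im us ic mB.
(* All constraints that [c] places on coordinate [j], which avoids choosing an inverse of [c]:
   injectivity leaves at most one constraint, and off the image the set is everything. *)
pose B' j : set E := [set e | forall k, k \in s -> c k = j -> B k e].
have B'E k : k \in s -> B' (c k) = B k.
  move=> ks; apply/seteqP; split => e /=; first by apply.
  by move=> Be k' k's /(ic _ _ k's ks) ->.
have mB' j : measurable (B' j).
  have [/mapP[k ks ->]|jn] := boolP (j \in map c s); first by rewrite B'E.
  rewrite (_ : B' j = setT)//; apply/seteqP; split => // e _ k ks kj.
  by move: jn; rewrite -kj map_f.
have := im (map c s) B'; rewrite map_inj_in_uniq// => /(_ us mB').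
rewrite big_map big_seq; under eq_bigr => k ks do rewrite (B'E _ ks).
rewrite -big_seq => <-.
  congr (m _); apply/seteqP; split => w /=.
    by move=> H j /mapP[k ks ->]; rewrite B'E//; exact: H.
  by move=> H k ks; rewrite -B'E//; apply: H; rewrite map_f.
Qed.

End SequenceSpace.
Arguments coord_sets : clear implicits.
Arguments coord_sets I {dE} E.

(** * Assembling a path from two independent copies *)

Section TwoCopies.
Context {I K : eqType} {dE} {E : measurableType dE} {R : realType}.
Variables (m : probability (seqspace I E) R) (n : probability (seqspace K E) R).
Variables (side : K -> bool) (c : K -> I).

(** The choice of copy and of coordinate is left free, so that this covers both the conditional
    expectations ([mix]) and the coupling with [eps0'] ([mpres_coupling]). *)
Definition splice (z : seqspace I E * seqspace I E) : seqspace K E :=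
  fun k => if side k then z.1 (c k) else z.2 (c k).

Lemma measurable_splice : measurable_fun setT splice.
Proof.
apply: measurable_to_seqspace => k; rewrite /splice; case: (side k).
  exact: (measurableT_comp (measurable_coord (c k)) measurable_fst).
exact: (measurableT_comp (measurable_coord (c k)) measurable_snd).
Qed.

(** Injectivity of [c] is required on each side separately: a coordinate may be read once from
    either copy, as the copies are independent. *)
Lemma mpres_splice : indep_coord m -> indep_coord n ->
  (forall k B, measurable B -> n ((fun w : seqspace K E => w k) @^-1` B) =
                               m ((fun w : seqspace I E => w (c k)) @^-1` B)) ->
  (forall k k', side k = side k' -> c k = c k' -> k = k') ->
  mpres (m \x m)%E n splice.
Proof.
move=> im inn nm inj; apply: mpres_seqspace.
  by move=> k; exact: (measurableT_comp (measurable_coord k) measurable_splice).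
move=> J B uJ mB.
pose A b := [set w : seqspace I E | forall k, k \in [seq k <- J | side k == b] -> B k (w (c k))].
have uF b : uniq [seq k <- J | side k == b] by exact: filter_uniq.
have injF b : {in [seq k <- J | side k == b] &, injective c}.
  move=> k k'; rewrite !mem_filter => /andP[/eqP kb _] /andP[/eqP kb' _].
  by apply: inj; rewrite kb.
have mA b : measurable (A b).
  rewrite (_ : A b = \big[setI/setT]_(k <- [seq k <- J | side k == b])
      ((fun w : seqspace I E => w (c k)) @^-1` B k)).
    elim: [seq _ <- J | _] => [|j s IH]; first by rewrite big_nil.
    rewrite big_cons; apply: measurableI => //.
    by rewrite -[X in measurable X]setTI; exact: measurable_coord.
  rewrite /A; elim: [seq _ <- J | _] => [|j s IH].
    by rewrite big_nil; apply/seteqP; split.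
  rewrite big_cons -IH; apply/seteqP; split => w /=.
    by move=> H; split=> [|i iJ]; apply: H; rewrite inE ?eqxx// iJ orbT.
  by move=> [Bj H] i; rewrite inE => /predU1P[->//|]; exact: H.
(* The constraints split according to the copy they concern, so the preimage is a rectangle and its
   measure is a product. *)
have -> : splice @^-1` cyl J B = A true `*` A false.
  apply/seteqP; split => z /=.
    move=> H; split=> k; rewrite mem_filter => /andP[/eqP kb /H];
    by rewrite /splice kb.
  move=> [H1 H2] k kJ; rewrite /splice.
  by case kb: (side k); [apply: H1|apply: H2]; rewrite mem_filter kJ kb.
have AE b : m (A b) = (\prod_(k <- [seq k <- J | side k == b])
    m ((fun w : seqspace I E => w (c k)) @^-1` B k))%E.
  exact: (indep_coord_map im (uF b) (@injF b) mB).
transitivity (m (A true) * m (A false))%E; first exact: product_measure1E.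
rewrite !AE inn// !big_filter [RHS](bigID (fun k => side k == true))/=.
by congr (_ * _)%E; apply: eq_big => [k|k _]; rewrite ?nm//; case: (side k).
Qed.

End TwoCopies.

(** * Decay of the dependence on the remote past *)

Section Approximation.
Import HBSimple HBNNSimple.
Context {d} {T : measurableType d} {R : realType} (m : probability T R).

Lemma nrmZ r (c : R) (f : T -> R) : 1 <= r -> f \in Lfun m r%:E ->
  (fun x => c * f x) \in Lfun m r%:E /\
  nrm m r (fun x => c * f x) = `|c| * nrm m r f.
Proof.
move=> r1; have r0 : 0 < r by lra.
move=> lf; have mf := Lfun_measurable lf.
have I := (Lfun_integrable_powR m r0 mf).1 lf.
have E : (fun x => `|c * f x| `^ r) = (fun x => `|c| `^ r * `|f x| `^ r).
  by apply/funext => x; rewrite normrM powRM.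
have lcf : (fun x => c * f x) \in Lfun m r%:E.
  apply/(Lfun_integrable_powR m r0 (measurable_funM (measurable_cst c) mf)).
  by rewrite E; exact: (integrableZl measurableT (`|c| `^ r) I).
split => //.
rewrite (nrm_mom r0 lcf) (nrm_mom r0 lf) /mom E RintegralZl//.
rewrite powRM ?powR_ge0// -?powRrM ?mulfV ?gt_eqF// ?powRr1//.
exact: (mom_ge0 m r f).
Qed.

Lemma nnsfun_dense_Lfun r (F : T -> R) (e : R) : 1 <= r -> F \in Lfun m r%:E ->
  (forall x, 0 <= F x) -> 0 < e ->
  exists g : {nnsfun T >-> R}, (g : T -> R) \in Lfun m r%:E /\
    nrm m r (fun x => F x - g x) <= e.
Proof.
move=> r1; have r0 : 0 < r by lra.
move=> lF F0 e0; have mF := Lfun_measurable lF.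
have mEF : measurable_fun setT (EFin \o F) by exact/measurable_EFinP.
pose g := nnsfun_approx measurableT mEF.
have gF n x : g n x <= F x.
  rewrite -lee_fin /g nnsfun_approxE.
  by apply: (@le_approx _ _ _ setT (EFin \o F)) => // y _; rewrite lee_fin.
have gc x : (g n x) @[n --> \oo] --> F x.
  have F0' y : setT y -> (0 <= (EFin \o F) y)%E by rewrite lee_fin.
  by have /fine_cvgP[] := @cvg_nnsfun_approx _ _ _ setT measurableT _ mEF F0' x I.
have g0 n x : 0 <= g n x by exact: fun_ge0.
have mg n : measurable_fun setT (fun x => F x - g n x) by exact: measurable_funB.
have lg n : (g n : T -> R) \in Lfun m r%:E.
  apply: (Lfun_le r1 _ _ lF) => // x.
  by rewrite !ger0_norm.
have I := (Lfun_integrable_powR m r0 mF).1 lF.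
pose f_ n x := (`|F x - g n x| `^ r)%:E.
have [||||_ _] := @dominated_convergence _ _ _ m setT measurableT f_ (cst 0%E)
   (fun x => (`|F x| `^ r)%:E) _ _ _ I.
- by move=> n; exact/measurable_EFinP/measurable_normr_powR.
- exact: measurable_cst.
- apply: aeW => x _; apply: cvg_EFin; first by near=> n.
  rewrite /comp /=.
  apply: (@squeeze_cvgr _ _ _ _ (fun=> 0) (fun n => `|F x - g n x|)).
  (* Eventually [|F x - g n x| <= 1], and then its power with exponent [r >= 1] is at most
     itself. *)
  + near=> n; rewrite powR_ge0/=.
    have [->|Fg] := eqVneq (F x - g n x) 0.
      by rewrite normr0 powR0// gt_eqF.
    apply: ge1r_powR => //; rewrite normr_gt0 Fg/= distrC ltW//.
    near: n; move/cvgrPdistC_lt : (gc x); exact.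
  + exact: cvg_cst.
  + rewrite -(normr0 R) -(subrr (F x)); apply: cvg_norm.
    by apply: cvgB => //; exact: cvg_cst.
- apply: aeW => x n _; rewrite /f_ gee0_abs ?lee_fin ?powR_ge0//.
  apply: ge0_ler_powR; rewrite ?nnegrE//; first exact: ltW.
  by rewrite !ger0_norm ?subr_ge0// gerBl.
move=> cv.
have e0' : 0 < e `^ r by rewrite powR_gt0.
rewrite integral0 in cv; move/fine_cvgP : cv => [_ /cvgrPdist_lt /(_ _ e0')[N _ /(_ N (leqnn N))]].
rewrite sub0r normrN => H.
exists (g N); split => //.
have lFg := LfunB r1 lF (lg N).
have -> : e = (e `^ r) `^ r^-1 by rewrite -powRrM mulfV ?gt_eqF// powRr1// ltW.
rewrite (nrm_mom r0 lFg); apply: ge0_ler_powR; rewrite ?nnegrE ?invr_ge0 ?mom_ge0 ?powR_ge0//.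
  exact: ltW.
rewrite /mom /Rintegral; apply: ltW; apply: le_lt_trans H.
rewrite (le_trans _ (ler_norm _))//= le_eqVlt; apply/orP; left; apply/eqP; congr fine.
Unshelve. all: by end_near.
Qed.

End Approximation.

Section Mixing.
Context {dE} {E : measurableType dE} {R : realType}.
Let Omega := seqspace int E.
Variable m : probability Omega R.
Hypothesis im : indep_coord m.

(** The paths [mix k z] and [mix (k - 1) z] differ at most in coordinate [k]. Each coordinate keeps
    its own index, so independence suffices for [mix k] to preserve the law. *)
Definition mix (k : int) : Omega * Omega -> Omega := splice (fun i => i <= k) id.

Lemma mpres_mix k : mpres (m \x m)%E m (mix k).
Proof. by apply: mpres_splice. Qed.

Lemma measurable_mix k : measurable_fun setT (mix k).
Proof. exact: measurable_splice. Qed.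

Definition mismatch k (G : set Omega) : set (Omega * Omega) :=
  (mix k @^-1` G `\` snd @^-1` G) `|` (snd @^-1` G `\` mix k @^-1` G).

Lemma measurable_mismatch k G : measurable G -> measurable (mismatch k G).
Proof.
move=> mG; have mG1 : measurable (mix k @^-1` G).
  by rewrite -[X in measurable X]setTI; exact: measurable_mix.
have mG2 : measurable (snd @^-1` G : set (Omega * Omega)).
  by rewrite -[X in measurable X]setTI; exact: measurable_snd.
by apply: measurableU; exact: measurableD.
Qed.

(* The sets on which the two copies asymptotically agree when only the remote
   past is read from the first one; they form a sigma-algebra containing the
   cylinders, which replaces the 0-1 law. *)
Definition tail_trivial (G : set Omega) := measurable G /\
  forall e : R, 0 < e -> exists K : int, forall k, k <= K ->
    ((m \x m)%E (mismatch k G) <= e%:E)%E.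

Lemma mismatchU k A B : mismatch k (A `|` B) `<=` mismatch k A `|` mismatch k B.
Proof.
move=> z [[[?|?] /not_orP[? ?]]|[[?|?] /not_orP[? ?]]];
  by [left; left|right; left|left; right|right; right].
Qed.

Lemma tail_trivialU A B : tail_trivial A -> tail_trivial B -> tail_trivial (A `|` B).
Proof.
move=> [mA HA] [mB HB]; split; first exact: measurableU.
move=> e e0; have e2 : 0 < e / 2 by rewrite divr_gt0.
have [K1 H1] := HA _ e2; have [K2 H2] := HB _ e2.
exists (Num.min K1 K2) => k; rewrite le_min => /andP[k1 k2].
apply: (@le_trans _ _ ((m \x m)%E (mismatch k A `|` mismatch k B))).
  apply: le_measure; rewrite ?inE.
  - by apply: measurable_mismatch; exact: measurableU.
  - by apply: measurableU; exact: measurable_mismatch.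
  - exact: mismatchU.
apply: (le_trans (measureU2 _ _ _)); try exact: measurable_mismatch.
by rewrite [e]splitr EFinD; apply: leeD; [exact: H1|exact: H2].
Qed.

Lemma tail_trivial0 : tail_trivial set0.
Proof.
split => // e e0; exists 0 => k _.
rewrite (_ : mismatch k set0 = set0) ?measure0 ?lee_fin ?ltW//.
by apply/seteqP; split => // z [[]|[]].
Qed.

Lemma tail_trivialC A : tail_trivial A -> tail_trivial (~` A).
Proof.
move=> [mA HA]; split; first exact: measurableC.
move=> e /HA[K H]; exists K => k /H; apply: le_trans.
rewrite (_ : mismatch k (~` A) = mismatch k A)//.
apply/seteqP; split => z; rewrite /mismatch/=; case: (pselect (A (mix k z))); case: (pselect (A z.2)); tauto.
Qed.

(** A finite union exhausts the countable one up to a remainder [V] of measure at most [e / 3]. A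
    mismatch for the whole union is a mismatch for the finite one, or else one of the two paths lies
    in [V]; both paths have law [m], which gives three errors of size [e / 3]. *)
Lemma tail_trivial_bigcup (A : (set Omega)^nat) :
  (forall n, tail_trivial (A n)) -> tail_trivial (\bigcup_n A n).
Proof.
move=> HA; have mA n := (HA n).1.
have mU : measurable (\bigcup_n A n) by exact: bigcupT_measurable.
split => // e e0; have e3 : 0 < e / 3 by rewrite divr_gt0.
pose U n := \big[setU/set0]_(i < n) A i.
have HU n : tail_trivial (U n).
  rewrite /U; elim: n => [|n IH]; first by rewrite big_ord0; exact: tail_trivial0.
  by rewrite big_ord_recr; exact: tail_trivialU.
have UE : \bigcup_n U n = \bigcup_n A n.
  apply/seteqP; split => w [n _].
    by rewrite /U -bigcup_mkord => -[i _ Aw]; exists i.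
  by move=> Aw; exists n.+1 => //; rewrite /U -bigcup_mkord; exists n => /=.
have cv : m (U n) @[n --> \oo] --> m (\bigcup_n A n).
  rewrite -UE; apply: nondecreasing_cvg_mu.
  - by move=> n; exact: (HU n).1.
  - by rewrite UE.
  - by apply/nondecreasing_seqP => n; rewrite /U big_ord_recr; apply/subsetPset; left.
have fm B : measurable B -> m B \is a fin_num by exact: fin_num_measure.
have [N HN] : exists N, (m ((\bigcup_n A n) `\` U N) <= (e / 3)%:E)%E.
  have cvf : fine (m (U n)) @[n --> \oo] --> fine (m (\bigcup_n A n)).
    by apply: fine_cvg; rewrite (fineK (fm _ mU)).
  move/cvgrPdist_le : cvf => /(_ _ e3)[N _ /(_ N (leqnn N))] H.
  have muy : (m (\bigcup_n A n) < +oo)%E.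
    by apply: (le_lt_trans (probability_le1 _ mU)); rewrite ltry.
  exists N; rewrite (measureD mU (HU N).1 muy).
  rewrite setIidr; last by rewrite -UE; exact: bigcup_sup.
  have : ((fine (m (\bigcup_n A n)) - fine (m (U N)))%:E <= (e / 3)%:E)%E.
    by rewrite lee_fin; exact: le_trans (ler_norm _) H.
  by rewrite EFinB (fineK (fm _ mU)) (fineK (fm _ (HU N).1)).
have [_ /(_ _ e3)[K HK]] := HU N.
set V := (\bigcup_n A n) `\` U N in HN.
have mV : measurable V by apply: measurableD => //; exact: (HU N).1.
exists K => k /HK {}HK.
have sub : mismatch k (\bigcup_n A n) `<=`
    mismatch k (U N) `|` ((mix k @^-1` V) `|` (snd @^-1` V)).
  have Usub x : U N x -> (\bigcup_n A n) x by rewrite -UE => ?; exists N.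
  move=> z [[z1 z2]|[z1 z2]].
    have [u|u] := pselect (U N (mix k z)); last by right; left.
    by left; left; split => // /Usub.
  have [u|u] := pselect (U N z.2); last by right; right.
  by left; right; split => // /Usub.
have mV1 : measurable (mix k @^-1` V).
  by rewrite -[X in measurable X]setTI; exact: measurable_mix.
have mV2 : measurable (snd @^-1` V : set (Omega * Omega)).
  by rewrite -[X in measurable X]setTI; exact: measurable_snd.
have mD : measurable (mismatch k (U N)) by exact: measurable_mismatch (HU N).1.
apply: (@le_trans _ _ ((m \x m)%E (mismatch k (U N) `|` ((mix k @^-1` V) `|` (snd @^-1` V))))).
  apply: le_measure; rewrite ?inE//; first exact: measurable_mismatch.
  by apply: measurableU => //; exact: measurableU.
have -> : e = e / 3 + (e / 3 + e / 3) by field.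
apply: (le_trans (measureU2 _ _ _)) => //; first exact: measurableU.
rewrite EFinD; apply: leeD => //.
apply: (le_trans (measureU2 _ _ _)) => //.
rewrite EFinD; apply: leeD.
  apply: le_trans HN; rewrite le_eqVlt; apply/orP; left; apply/eqP.
  exact: ((mpres_mix k).2 _ mV).
apply: le_trans HN; rewrite le_eqVlt; apply/orP; left; apply/eqP.
exact: ((mpres_snd m m).2 _ mV).
Qed.

Lemma measurable_tail_trivial A : measurable A -> tail_trivial A.
Proof.
move=> mA; apply: (@smallest_sub _ _ _ _ _ _ A mA).
  split; first exact: tail_trivial0.
    by move=> B HB; rewrite setTD; exact: tail_trivialC.
  exact: tail_trivial_bigcup.
move=> _ [i [B [mB ->]]]; split.
  by rewrite -[X in measurable X]setTI; exact: measurable_coord.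
(* For [k < i] both [mix k z] and [z.2] take coordinate [i] from the second copy, so a mismatch is
   impossible. *)
move=> e e0; exists (i - 1) => k ki.
rewrite (_ : mismatch _ _ = set0) ?measure0 ?lee_fin ?ltW//.
apply/seteqP; split => // z; rewrite /mismatch /mix /splice/=.
by have -> : (i <= k) = false by [apply/negP; lia]; move=> [[]|[]].
Qed.

(** The analogue of [tail_trivial] for functions, measured in the norm of exponent [r]. *)
Definition tail_cvg r (F : Omega -> R) := F \in Lfun m r%:E /\
  forall e : R, 0 < e -> exists K : int, forall k, k <= K ->
    nrm (m \x m)%E r (fun z => F (mix k z) - F z.2) <= e.

Lemma Lfun_mix r k (F : Omega -> R) : 1 <= r -> F \in Lfun m r%:E ->
  (fun z => F (mix k z)) \in Lfun (m \x m)%E r%:E.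
Proof. by move=> r1; apply: (Lfun_mpres (mpres_mix k)); lra. Qed.

Lemma Lfun_snd r (F : Omega -> R) : 1 <= r -> F \in Lfun m r%:E ->
  (fun z => F z.2) \in Lfun (m \x m)%E r%:E.
Proof. by move=> r1; apply: (Lfun_mpres (mpres_snd m m)); lra. Qed.

Lemma Lfun_mixB r k (F : Omega -> R) : 1 <= r -> F \in Lfun m r%:E ->
  (fun z => F (mix k z) - F z.2) \in Lfun (m \x m)%E r%:E.
Proof.
by move=> r1 lF; apply: (LfunB r1); [exact: Lfun_mix|exact: Lfun_snd].
Qed.

Lemma tail_cvgD r F G : 1 <= r -> tail_cvg r F -> tail_cvg r G ->
  tail_cvg r (fun x => F x + G x).
Proof.
move=> r1 [lF HF] [lG HG]; split; first exact: LfunD.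
move=> e e0; have e2 : 0 < e / 2 by rewrite divr_gt0.
have [K1 H1] := HF _ e2; have [K2 H2] := HG _ e2.
exists (Num.min K1 K2) => k; rewrite le_min => /andP[k1 k2].
rewrite (_ : (fun z => _) = (fun z => (F (mix k z) - F z.2) + (G (mix k z) - G z.2))).
  apply: (le_trans (nrmD r1 (Lfun_mixB k r1 lF) (Lfun_mixB k r1 lG))).
  by rewrite [e]splitr; apply: lerD; [exact: H1|exact: H2].
by apply/funext => z; ring.
Qed.

Lemma tail_cvgZ r (c : R) F : 1 <= r -> tail_cvg r F -> tail_cvg r (fun x => c * F x).
Proof.
move=> r1 [lF HF]; split; first exact: (nrmZ c r1 lF).1.
move=> e e0; have e2 : 0 < e / (`|c| + 1) by rewrite divr_gt0// ltr_wpDl.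
have [K H] := HF _ e2; exists K => k /H {}H.
rewrite (_ : (fun z => _) = (fun z => c * (F (mix k z) - F z.2))).
  rewrite (nrmZ c r1 (Lfun_mixB k r1 lF)).2.
  apply: (le_trans (ler_wpM2l (normr_ge0 c) H)).
  rewrite mulrCA ler_piMr ?(ltW e0)// ler_pdivrMr ?ltr_wpDl// mul1r.
  by rewrite lerDl.
by apply/funext => z; ring.
Qed.

Lemma tail_cvg_sum r (J : Type) (s : seq J) (F : J -> Omega -> R) : 1 <= r ->
  (forall j, tail_cvg r (F j)) -> tail_cvg r (fun x => \sum_(j <- s) F j x).
Proof.
move=> r1 H; elim: s => [|j s IH].
  rewrite (_ : (fun x => _) = fun=> 0); last by apply/funext => x; rewrite big_nil.
  split; first exact: Lfun0.
  move=> e e0; exists 0 => k _.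
  rewrite (_ : (fun z => _) = fun=> 0); last by apply/funext => x; rewrite subrr.
  by rewrite nrm0 ?ltW//; lra.
rewrite (_ : (fun x => _) = fun x => F j x + \sum_(j <- s) F j x).
  exact: tail_cvgD.
by apply/funext => x; rewrite big_cons.
Qed.

(** The [r]-th power of the distance between the two indicator values is exactly the indicator of
    the mismatch set. *)
Lemma tail_cvg_indic r (G : set Omega) : 1 <= r -> measurable G ->
  tail_cvg r (\1_G : Omega -> R).
Proof.
move=> r1 mG; have r0 : 0 < r by lra.
have lG : (\1_G : Omega -> R) \in Lfun m r%:E.
  apply: (Lfun_le (g := fun=> 1) r1); [exact: measurable_indic| |exact: Lfun_cst].
  by move=> x; rewrite indicE normr1; case: (_ \in _); rewrite ?normr1 ?normr0.
split => // e e0; have [_ H] := measurable_tail_trivial mG.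
have er0 : 0 < e `^ r by rewrite powR_gt0.
have [K HK] := H _ er0; exists K => k /HK {H HK}.
have mM := measurable_mismatch k mG.
have L := Lfun_mixB k r1 lG.
have -> : ((m \x m)%E (mismatch k G) = (mom (m \x m)%E r
    (fun z => \1_G (mix k z) - \1_G z.2 : R))%:E)%E.
  rewrite (momE r0 L) -[LHS]/((m \x m)%E (mismatch k G)).
  transitivity (\int[(m \x m)%E]_z (\1_(mismatch k G) z)%:E)%E.
    by rewrite integral_indic// setIT.
  apply: eq_integral => z _; congr EFin.
  rewrite !indicE.
  have -> : (z \in mismatch k G) = ((mix k z \in G) (+) (z.2 \in G)).
    apply/idP/idP => [|/addbP].
      move=> /set_mem[[z1 z2]|[z1 z2]].
        by rewrite (mem_set (z1 : G (mix k z))) (memNset (z2 : ~ G z.2)).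
      by rewrite (mem_set (z1 : G z.2)) (memNset (z2 : ~ G (mix k z))).
    case z1: (mix k z \in G); case z2: (z.2 \in G) => // _; rewrite inE.
      left; split; first exact: (set_mem z1 : G (mix k z)).
      by move=> /(mem_set : G z.2 -> _); rewrite z2.
    right; split; first exact: (set_mem z2 : G z.2).
    by move=> /(mem_set : G (mix k z) -> _); rewrite z1.
  case: (_ \in G); case: (_ \in G) => /=; rewrite ?subrr ?subr0 ?sub0r ?normrN
    ?normr1 ?normr0 ?powR1 ?powR0// gt_eqF//.
rewrite lee_fin => H.
rewrite (nrm_mom r0 L).
have -> : e = (e `^ r) `^ r^-1 by rewrite -powRrM mulfV ?gt_eqF// powRr1// ltW.
by apply: ge0_ler_powR; rewrite ?nnegrE ?invr_ge0 ?powR_ge0 ?mom_ge0//; exact: ltW.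
Qed.

(** Since [mix k] and [snd] both preserve the law, replacing [F] by [G] costs the same error on
    either path, uniformly in [k]. *)
Lemma tail_cvg_approx r F : 1 <= r -> F \in Lfun m r%:E ->
  (forall e : R, 0 < e -> exists G, tail_cvg r G /\ nrm m r (fun x => F x - G x) <= e) ->
  tail_cvg r F.
Proof.
move=> r1 lF H; split => // e e0; have e3 : 0 < e / 3 by rewrite divr_gt0.
have [G [[lG HG] FG]] := H _ e3.
have [K HK] := HG _ e3; exists K => k /HK {}HK.
have lFG := LfunB r1 lF lG.
have mFG := Lfun_measurable lFG.
have l1 := Lfun_mix k r1 lFG; have l2 := Lfun_snd r1 lFG; have l3 := Lfun_mixB k r1 lG.
have l2' := LfunN r1 l2.
rewrite (_ : (fun z => _) = (fun z => ((F (mix k z) - G (mix k z)) +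
    (- (F z.2 - G z.2))) + (G (mix k z) - G z.2))); last by apply/funext => z; ring.
apply: (le_trans (nrmD r1 (LfunD r1 l1 l2') l3)).
rewrite [leRHS](_ : e = (e / 3 + e / 3) + e / 3); last by field.
apply: lerD => //; apply: (le_trans (nrmD r1 l1 l2')); apply: lerD.
  by rewrite (nrm_mpres (mpres_mix k) r mFG).
rewrite (_ : (fun z => - _) = (fun z => -1 * (F z.2 - G z.2))); last first.
  by apply/funext => z; rewrite mulN1r.
by rewrite (nrmZ _ r1 l2).2 normrN1 mul1r (nrm_mpres (mpres_snd m m) r mFG).
Qed.

Import HBSimple HBNNSimple.

Lemma tail_cvg_nnsfun r (g : {nnsfun Omega >-> R}) : 1 <= r -> tail_cvg r g.
Proof.
move=> r1.
rewrite (_ : (g : Omega -> R) = fun x => \sum_(y <- finmap.enum_fset (fset_set (range g)))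
    (y * \1_(g @^-1` [set y]) x)).
  by apply: tail_cvg_sum => // y; apply: tail_cvgZ => //; exact: tail_cvg_indic.
by apply/funext => x; rewrite fimfunE fsbig_finite.
Qed.

Lemma Lfun_tail_cvg r F : 1 <= r -> F \in Lfun m r%:E -> tail_cvg r F.
Proof.
move=> r1 lF; have mF := Lfun_measurable lF.
have pos G : G \in Lfun m r%:E -> (forall x, 0 <= G x) -> tail_cvg r G.
  move=> lG G0; apply: tail_cvg_approx => // e e0.
  have [g [_ Hg]] := nnsfun_dense_Lfun r1 lG G0 e0.
  by exists g; split => //; exact: tail_cvg_nnsfun.
rewrite (_ : F = fun x => Num.max (F x) 0 + -1 * Num.max (- F x) 0).
  apply: tail_cvgD => //; last apply: tail_cvgZ => //; apply: pos.
  - apply: (Lfun_le r1 _ _ lF); first exact: measurable_maxr.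
    by move=> x; case: (leP (F x) 0) => //; rewrite normr0.
  - by move=> x; rewrite le_max lexx orbT.
  - apply: (Lfun_le r1 _ _ lF).
      by apply: measurable_maxr => //; exact: measurableT_comp.
    by move=> x; case: (leP (- F x) 0); rewrite ?normr0 ?normrN.
  - by move=> x; rewrite le_max lexx orbT.
apply/funext => x; case: (leP (F x) 0); case: (leP (- F x) 0); lra.
Qed.

End Mixing.

(** * Moment bounds for centered functionals *)

(** Jensen's inequality in the second variable. The difference of the two averages is the average of
    the difference only almost everywhere, because sections may fail to be integrable on a null
    set. *)
Lemma mom_avgB {d1 d2} {T1 : measurableType d1} {T2 : measurableType d2} {R : realType}
    (m1 : probability T1 R) (m2 : probability T2 R) r (G1 G2 : T1 * T2 -> R) :
  1 < r -> G1 \in Lfun (m1 \x m2)%E r%:E -> G2 \in Lfun (m1 \x m2)%E r%:E ->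
  mom m1 r (fun x => avg m2 G1 x - avg m2 G2 x) <=
  mom (m1 \x m2)%E r (fun z => G1 z - G2 z).
Proof.
move=> r1 l1 l2; have l12 := LfunB (ltW r1) l1 l2.
have i1 := Lfun_L1 (ltW r1) l1; have i2 := Lfun_L1 (ltW r1) l2.
have i12 := Lfun_L1 (ltW r1) l12.
apply: le_trans (Lfun_avg r1 l12).2.
rewrite le_eqVlt; apply/orP; left; apply/eqP; apply: mom_ae.
- by apply: measurable_funB; [exact: measurable_avg i1|exact: measurable_avg i2].
- exact: measurable_avg i12.
- by apply: filterS (avgB_ae i1 i2) => x.
Qed.

Section Martingale.
Context {dE} {E : measurableType dE} {R : realType}.
Let Omega := seqspace int E.
Variable m : probability Omega R.
Hypothesis im : indep_coord m.

(** Stated through coordinates instead of a sub-sigma-algebra: this form gives at once that an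
    adapted function of [mix k z] depends on [z.1] alone. *)
Definition adapted (k : int) (F : Omega -> R) :=
  forall w w' : Omega, (forall i, i <= k -> w i = w' i) -> F w = F w'.

(* The conditional expectation of [F] given the coordinates up to [k]; it takes
   the junk value 0 where the partial integral diverges. *)
Definition cexp k (F : Omega -> R) : Omega -> R := avg m (fun z => F (mix k z)).

Lemma adaptedW k l F : k <= l -> adapted k F -> adapted l F.
Proof. by move=> kl aF w w' ww'; apply: aF => i ik; apply: ww'; exact: le_trans kl. Qed.

Lemma adapted_cexp k F : adapted k (cexp k F).
Proof.
move=> w w' ww'; rewrite /cexp /avg; apply: eq_Rintegral => y _; congr F.
by apply/funext => i; rewrite /mix /splice; case: ifP => // /ww'.
Qed.

Lemma adaptedB k F G : adapted k F -> adapted k G -> adapted k (fun w => F w - G w).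
Proof. by move=> aF aG w w' ww'; rewrite (aF _ _ ww') (aG _ _ ww'). Qed.

Lemma adapted_mix k F z : adapted k F -> F (mix k z) = F z.1.
Proof. by move=> aF; apply: aF => i ik; rewrite /mix /splice ik. Qed.

Lemma cexp_adapted k F : adapted k F -> cexp k F = F.
Proof.
move=> aF; apply/funext => w; rewrite /cexp /avg -[RHS](Rintegral_cst1 m (F w)).
by apply: eq_Rintegral => y _; rewrite (adapted_mix _ aF).
Qed.

Lemma Lfun_cexp r k F : 1 < r -> F \in Lfun m r%:E -> cexp k F \in Lfun m r%:E.
Proof.
by move=> r1 lF; exact: (Lfun_avg r1 (Lfun_mix im k (ltW r1) lF)).1.
Qed.

Lemma mom_cexpB r k l F : 1 < r -> F \in Lfun m r%:E ->
  mom m r (fun w => cexp k F w - cexp l F w) <=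
  mom (m \x m)%E r (fun z => F (mix k z) - F (mix l z)).
Proof.
by move=> r1 lF; apply: mom_avgB => //; apply: Lfun_mix => //; exact: ltW.
Qed.

Lemma mom_cexp_mean r k F : 1 < r -> F \in Lfun m r%:E ->
  mom m r (fun w => cexp k F w - \int[m]_y F y) <=
  mom (m \x m)%E r (fun z => F (mix k z) - F z.2).
Proof.
move=> r1 lF; have := mom_avgB r1 (Lfun_mix im k (ltW r1) lF) (Lfun_snd (ltW r1) lF).
exact.
Qed.

(** An adapted factor takes the same value at [z.1] and at [mix k z], so Fubini's theorem yields an
    integral over [mix k z], which has law [m]. *)
Lemma Rintegral_cexp k (h F : Omega -> R) : measurable_fun setT h -> adapted k h ->
  m.-integrable setT (EFin \o F) -> m.-integrable setT (EFin \o (fun w => h w * F w)) ->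
  \int[m]_w (h w * cexp k F w) = \int[m]_w (h w * F w).
Proof.
move=> mh ah iF ihF.
have i1 := integrable_mpres (mpres_mix im k) iF.
have i2 := integrable_mpres (mpres_mix im k) ihF.
have E1 : (fun z => h (mix k z) * F (mix k z)) = (fun z => h z.1 * F (mix k z)).
  by apply/funext => z; rewrite (adapted_mix _ ah).
rewrite E1 in i2; rewrite (Rintegral_avgM mh i1 i2) -E1.
apply: (Rintegral_mpres (mpres_mix im k) (f := fun w => h w * F w)).
by apply/measurable_EFinP; exact: measurable_int ihF.
Qed.

(** The multiplier is adapted to [k - 1], hence also to [k], so both conditional expectations can be
    replaced by [F] under the integral. *)
Lemma Rintegral_martingale r k F S : 1 < r -> F \in Lfun m r%:E ->
  S \in Lfun m r%:E -> adapted (k - 1) S ->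
  \int[m]_w (sgpow r (S w) * (cexp k F w - cexp (k - 1) F w)) = 0.
Proof.
move=> r1 lF lS aS.
have mh := measurable_sgpow r (Lfun_measurable lS).
have ah : adapted (k - 1) (fun w => sgpow r (S w)).
  by move=> w w' ww'; rewrite (aS _ _ ww').
have ah' : adapted k (fun w => sgpow r (S w)).
  by apply: adaptedW ah; lia.
have i1 := integrable_sgpowM r1 lS (Lfun_cexp k r1 lF).
have i2 := integrable_sgpowM r1 lS (Lfun_cexp (k - 1) r1 lF).
have iF := Lfun_L1 (ltW r1) lF; have iSF := integrable_sgpowM r1 lS lF.
under eq_Rintegral do rewrite mulrBr.
by rewrite RintegralB// !(Rintegral_cexp mh)// subrr.
Qed.

(* The remaining term [cexp (n - K) F - EF] tends to 0 as [K] grows. *)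
Lemma nrm_centered_le r n F (C : R) : 1 < r -> F \in Lfun m r%:E -> adapted n F ->
  0 <= C ->
  (forall K : nat, mom m r (fun w => cexp n F w - cexp (n - K%:Z) F w) <= C) ->
  nrm m r (fun w => F w - \int[m]_y F y) <= C `^ r^-1.
Proof.
move=> r1; have r0 : 0 < r by lra.
move=> lF aF C0 H; apply/ler_addgt0Pr => e e0.
have [_ /(_ _ e0)[K0 HK0]] := Lfun_tail_cvg im (ltW r1) lF.
pose K := `|n - K0|%N.
have /HK0 {}HK0 : n - K%:Z <= K0 by rewrite /K; lia.
have lc := Lfun_cexp (n - K%:Z) r1 lF.
have lcst : (fun=> \int[m]_y F y) \in Lfun m r%:E by exact: Lfun_cst.
have l1 := LfunB (ltW r1) lF lc; have l2 := LfunB (ltW r1) lc lcst.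
rewrite (_ : (fun w => _) = (fun w => (F w - cexp (n - K%:Z) F w) +
   (cexp (n - K%:Z) F w - \int[m]_y F y))); last by apply/funext => w; ring.
apply: (le_trans (nrmD (ltW r1) l1 l2)); apply: lerD.
  rewrite (nrm_mom r0 l1); apply: ge0_ler_powR; rewrite ?nnegrE ?invr_ge0 ?mom_ge0//.
    exact: ltW.
  by have := H K; rewrite (cexp_adapted aF).
have lm := Lfun_mixB im (n - K%:Z) (ltW r1) lF.
apply: le_trans HK0; rewrite (nrm_mom r0 l2) (nrm_mom r0 lm).
apply: ge0_ler_powR; rewrite ?nnegrE ?invr_ge0 ?mom_ge0//; first exact: ltW.
exact: mom_cexp_mean.
Qed.

Lemma moment_bound12 r n F (b : nat -> R) (B : R) : 1 < r -> r <= 2 ->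
  F \in Lfun m r%:E -> adapted n F ->
  (forall i : nat, mom (m \x m)%E r
     (fun z => F (mix (n - i%:Z) z) - F (mix (n - i%:Z - 1) z)) <= b i) ->
  (forall K : nat, \sum_(0 <= i < K) b i <= B) ->
  nrm m r (fun w => F w - \int[m]_y F y) <= (20 * B) `^ r^-1.
Proof.
move=> r1 r2 lF aF Hb HB.
have B0 : 0 <= B by have := HB 0%N; rewrite big_geq.
apply: (nrm_centered_le r1 lF aF) => [|K]; first by rewrite mulr_ge0.
(* The starting time varies in the induction because each step adds the newest difference to the sum
   of the older ones, which is adapted to the preceding time. *)
suff H : forall d a : nat, mom m r (fun w => cexp (n - a%:Z) F w -
    cexp (n - a%:Z - d%:Z) F w) <= 20 * \sum_(a <= i < a + d) b i.
  by have := H K 0%N; rewrite subr0 add0n => /le_trans; apply; rewrite ler_pM2l.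
elim=> [|d IH] a.
  rewrite subr0 addn0 big_geq// mulr0 (_ : (fun w => _) = fun=> 0).
    by rewrite mom_nrm ?Lfun0 ?nrm0 ?powR0 ?gt_eqF//; lra.
  by apply/funext => w; rewrite subrr.
have Ea : n - a.+1%:Z = n - a%:Z - 1 by clear; lia.
have Ed : n - a%:Z - d.+1%:Z = n - a%:Z - 1 - d%:Z by clear; lia.
have lS := LfunB (ltW r1) (Lfun_cexp (n - a%:Z - 1) r1 lF)
  (Lfun_cexp (n - a%:Z - d.+1%:Z) r1 lF).
have lD := LfunB (ltW r1) (Lfun_cexp (n - a%:Z) r1 lF) (Lfun_cexp (n - a%:Z - 1) r1 lF).
have aS : adapted (n - a%:Z - 1) (fun w => cexp (n - a%:Z - 1) F w -
    cexp (n - a%:Z - d.+1%:Z) F w).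
  apply: adaptedB; first exact: adapted_cexp.
  by rewrite Ed; apply: adaptedW (@adapted_cexp _ _); clear; lia.
rewrite (_ : (fun w => _) = (fun w => (cexp (n - a%:Z - 1) F w -
    cexp (n - a%:Z - d.+1%:Z) F w) + (cexp (n - a%:Z) F w - cexp (n - a%:Z - 1) F w)));
  last by apply/funext => w; ring.
apply: (le_trans (mom_step12 r1 r2 lS lD (Rintegral_martingale r1 lF lS aS))).
rewrite big_ltn; last by clear; lia.
rewrite mulrDr addrC; apply: lerD.
  by rewrite ler_pM2l//; apply: le_trans (Hb a); exact: mom_cexpB.
by have := IH a.+1; rewrite addnS addSn Ea Ed.
Qed.

Lemma moment_bound24 r n F (b : nat -> R) (B : R) : 2 < r -> r <= 4 ->
  F \in Lfun m r%:E -> adapted n F -> (forall i, 0 <= b i) ->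
  (forall i : nat, mom (m \x m)%E r
     (fun z => F (mix (n - i%:Z) z) - F (mix (n - i%:Z - 1) z)) <= b i `^ (r / 2)) ->
  (forall K : nat, \sum_(0 <= i < K) b i <= B) ->
  nrm m r (fun w => F w - \int[m]_y F y) <= (40 * B) `^ 2^-1.
Proof.
move=> r2 r4; have r1 : 1 < r by lra.
have r0 : 0 < r by lra.
move=> lF aF b0 Hb HB.
have B0 : 0 <= B by have := HB 0%N; rewrite big_geq.
have -> : (40 * B) `^ 2^-1 = ((40 * B) `^ (r / 2)) `^ r^-1.
  by rewrite -powRrM; congr (_ `^ _); field; rewrite gt_eqF.
apply: (nrm_centered_le r1 lF aF) => [|K]; first exact: powR_ge0.
have S0 a c : 0 <= \sum_(a <= i < c) b i by apply: sumr_ge0.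
suff H : forall d a : nat, mom m r (fun w => cexp (n - a%:Z) F w -
    cexp (n - a%:Z - d%:Z) F w) <= (40 * \sum_(a <= i < a + d) b i) `^ (r / 2).
  have := H K 0%N; rewrite subr0 add0n => /le_trans; apply.
  have r20 : 0 <= r / 2 by rewrite divr_ge0 ?(ltW r0).
  by apply: ge0_ler_powR => //; rewrite ?nnegrE ?ler_pM2l// mulr_ge0.
elim=> [|d IH] a.
  rewrite subr0 addn0 big_geq// mulr0 (_ : (fun w => _) = fun=> 0).
    by rewrite mom_nrm ?Lfun0 ?nrm0 ?powR0 ?gt_eqF// divr_gt0.
  by apply/funext => w; rewrite subrr.
have Ea : n - a.+1%:Z = n - a%:Z - 1 by clear; lia.
have Ed : n - a%:Z - d.+1%:Z = n - a%:Z - 1 - d%:Z by clear; lia.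
have lS := LfunB (ltW r1) (Lfun_cexp (n - a%:Z - 1) r1 lF)
  (Lfun_cexp (n - a%:Z - d.+1%:Z) r1 lF).
have lD := LfunB (ltW r1) (Lfun_cexp (n - a%:Z) r1 lF) (Lfun_cexp (n - a%:Z - 1) r1 lF).
have aS : adapted (n - a%:Z - 1) (fun w => cexp (n - a%:Z - 1) F w -
    cexp (n - a%:Z - d.+1%:Z) F w).
  apply: adaptedB; first exact: adapted_cexp.
  by rewrite Ed; apply: adaptedW (@adapted_cexp _ _); clear; lia.
rewrite (_ : (fun w => _) = (fun w => (cexp (n - a%:Z - 1) F w -
    cexp (n - a%:Z - d.+1%:Z) F w) + (cexp (n - a%:Z) F w - cexp (n - a%:Z - 1) F w)));
  last by apply/funext => w; ring.
rewrite big_ltn; last by clear; lia.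
rewrite (addrC (b a)).
apply: (mom_step24 r2 r4 lS lD (Rintegral_martingale r1 lF lS aS)) => //.
  by have := IH a.+1; rewrite addnS addSn Ea Ed.
by apply: le_trans (Hb a); exact: mom_cexpB.
Qed.

End Martingale.

(** * Sums of squared block sums *)

Section ShiftedSums.
Context {R : realType} (delta : nat -> R) (Delta : R).
Hypotheses (delta0 : forall i, 0 <= delta i)
  (sum_delta : forall K, \sum_(0 <= i < K) delta i <= Delta).

(** Negative lags get the value 0: an innovation later than [j] does not influence [X j]. *)
Definition zext (z : int) : R := if 0 <= z then delta `|z|%N else 0.

Lemma zext_ge0 z : 0 <= zext z.
Proof. by rewrite /zext; case: ifP. Qed.

Lemma Delta_ge0 : 0 <= Delta.
Proof. by have := sum_delta 0; rewrite big_geq. Qed.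

Lemma sum_zext_le (a b : nat) (z : int) : \sum_(a <= j < b) zext (j%:Z + z) <= Delta.
Proof.
(* The number of non-negative lags below [x], which is 0 as long as the shifted index is still
   negative. *)
pose M (x : int) := absz (Num.max 0 x).
have H (c : nat) : \sum_(0 <= j < c) zext (j%:Z + z) <= \sum_(0 <= j < M (c%:Z + z)) delta j.
  elim: c => [|c IH]; first by rewrite big_geq// sumr_ge0.
  rewrite big_nat_recr//= {2}/zext; case: ifP => cz.
    have -> : M (c.+1%:Z + z) = (absz (c%:Z + z)).+1 by rewrite /M; clear - cz; lia.
    rewrite big_nat_recr//= lerD2r.
    by have -> : absz (c%:Z + z) = M (c%:Z + z) by rewrite /M; clear - cz; lia.
  rewrite addr0; have -> : M (c.+1%:Z + z) = M (c%:Z + z); last by [].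
  by move/negbT: cz; rewrite /M; clear; lia.
have [ab|ba] := leqP a b; last by rewrite big_geq ?Delta_ge0// ltnW.
apply: le_trans (le_trans (H b) (sum_delta _)).
rewrite [leRHS](@big_cat_nat _ _ _ a)//= lerDr sumr_ge0// => *; exact: zext_ge0.
Qed.

Lemma sum_zext_rev_le (a b : nat) (z : int) : \sum_(a <= j < b) zext (z - j%:Z) <= Delta.
Proof.
rewrite big_nat_rev/= (eq_big_nat _ _ (F2 := fun j => zext (j%:Z + (z + 1 - a%:Z - b%:Z)))).
  exact: sum_zext_le.
by move=> j /andP[aj jb]; congr zext; lia.
Qed.

End ShiftedSums.

Section BlockSums.
Context {dE} {E : measurableType dE} {R : realType}.
Let Omega := seqspace int E.
Variable m : probability Omega R.
Hypothesis im : indep_coord m.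
Variables (alpha : R) (X : int -> Omega -> R) (delta : nat -> R) (Delta : R).
Hypotheses (alpha2 : 2 < alpha) (alpha4 : alpha <= 4).
Hypotheses (delta0 : forall i, 0 <= delta i)
  (sum_delta : forall K, \sum_(0 <= i < K) delta i <= Delta).
Hypotheses (lX : forall j, X j \in Lfun m alpha%:E) (aX : forall j, adapted j (X j))
  (X0 : forall j, \int[m]_w X j w = 0)
  (dX : forall j k, nrm (m \x m)%E alpha
     (fun z => X j (mix k z) - X j (mix (k - 1) z)) <= zext delta (j - k)).

(** Counted backwards from the last time [i], so that blocks ending at [i] differ only in the range
    of [s]. *)
Definition block_sum (l i : nat) : Omega -> R :=
  fun w => \sum_(0 <= s < l) X (i%:Z - s%:Z) w.

Let alpha1 : 1 <= alpha. Proof. by have := alpha2; lra. Qed.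
Let alpha0 : 0 < alpha. Proof. by have := alpha2; lra. Qed.

Lemma Lfun_block_sum l i : block_sum l i \in Lfun m alpha%:E.
Proof. exact: Lfun_sum. Qed.

Lemma adapted_block_sum l i : adapted i%:Z (block_sum l i).
Proof.
move=> w w' ww'; apply: eq_bigr => s _; apply: aX => j js; apply: ww'.
by apply: (le_trans js); clear; lia.
Qed.

Lemma mean_block_sum l i : \int[m]_w block_sum l i w = 0.
Proof.
rewrite /block_sum; elim: l => [|l IH].
  by under eq_Rintegral do rewrite big_geq//; rewrite Rintegral_cst1.
under eq_Rintegral do rewrite big_nat_recr//=.
rewrite RintegralD//; first by rewrite IH X0 addr0.
  exact: (Lfun_L1 alpha1 (Lfun_block_sum l i)).
exact: (Lfun_L1 alpha1 (lX _)).
Qed.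

Lemma nrm_mixB_block_sum l i k : nrm (m \x m)%E alpha
    (fun z => block_sum l i (mix k z) - block_sum l i (mix (k - 1) z)) <=
  \sum_(0 <= s < l) zext delta (i%:Z - s%:Z - k).
Proof.
rewrite (_ : (fun z => _) = (fun z => \sum_(0 <= s < l)
    (X (i%:Z - s%:Z) (mix k z) - X (i%:Z - s%:Z) (mix (k - 1) z)))); last first.
  by apply/funext => z; rewrite /block_sum sumrB.
apply: (le_trans (nrm_sum _ alpha1 _)) => [s _|].
  by apply: (LfunB alpha1); apply: (Lfun_mix im _ alpha1); exact: lX.
by apply: ler_sum => s _; exact: dX.
Qed.

Lemma nrm_block_sum l i : nrm m alpha (block_sum l i) <= (40 * (Delta ^+ 2 * l%:R)) `^ 2^-1.
Proof.
have D0 := Delta_ge0 sum_delta.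
pose s (k : nat) := \sum_(0 <= s < l) zext delta (k%:Z - s%:Z).
have s0 k : 0 <= s k by apply: sumr_ge0 => *; exact: zext_ge0.
have sD k : s k <= Delta by exact: sum_zext_rev_le.
have := @moment_bound24 _ E R m im alpha i%:Z (block_sum l i) (fun k => s k ^+ 2)
  (Delta ^+ 2 * l%:R) alpha2 alpha4 (Lfun_block_sum l i) (@adapted_block_sum l i).
rewrite mean_block_sum (_ : (fun w => _ - 0) = block_sum l i); last first.
  by apply/funext => w; rewrite subr0.
apply.
- by move=> k; exact: sqr_ge0.
- move=> k.
  have lW := LfunB alpha1 (Lfun_mix im (i%:Z - k%:Z) alpha1 (Lfun_block_sum l i))
    (Lfun_mix im (i%:Z - k%:Z - 1) alpha1 (Lfun_block_sum l i)).
  rewrite (mom_nrm alpha0 lW) -powR_mulrn// -powRrM mulrC divfK//.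
  apply: ge0_ler_powR; rewrite ?nnegrE ?nrm_ge0//; first exact: ltW.
  apply: (le_trans (nrm_mixB_block_sum l i _)).
  by rewrite le_eqVlt; apply/orP; left; apply/eqP; apply: eq_bigr => j _;
    congr zext; clear; lia.
(* The double sum is used both ways: summing over the block bounds one factor [s k] of the square by
   [Delta], and summing over [k] for a fixed position bounds the total of the other by
   [l * Delta]. *)
- move=> K; apply: (@le_trans _ _ (\sum_(0 <= k < K) Delta * s k)).
    by apply: ler_sum => k _; rewrite expr2 ler_wpM2r.
  rewrite -mulr_sumr expr2 -mulrA ler_wpM2l// exchange_big/=.
  apply: (@le_trans _ _ (\sum_(0 <= j < l) Delta)).
    by apply: ler_sum => j _; exact: sum_zext_le.
  by rewrite sumr_const_nat subn0 -[Delta *+ _]mulr_natr.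
Qed.

Variables (n L : nat) (l : nat -> nat).
Hypothesis lL : forall i, (1 <= i)%N -> (i <= n)%N -> (l i <= L)%N.

Definition sum_sqr : Omega -> R :=
  fun w => \sum_(1 <= i < n.+1) (block_sum (l i) i w) ^+ 2.

Let q := alpha / 2.
Let q1 : 1 < q. Proof. by have := alpha2; rewrite /q; lra. Qed.
Let q2 : q <= 2. Proof. by have := alpha4; rewrite /q; lra. Qed.
Let alphaE : alpha = 2 * q. Proof. by rewrite /q; field. Qed.

Lemma Lfun_sqr_block_sum k i : (fun w => block_sum k i w ^+ 2) \in Lfun m q%:E.
Proof.
have lW := Lfun_block_sum k i; rewrite alphaE in lW.
have := (nrm_mul (ltW q1) lW lW).1.
by rewrite (_ : (fun x => _ * _) = fun w => block_sum k i w ^+ 2).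
Qed.

Lemma Lfun_sum_sqr : sum_sqr \in Lfun m q%:E.
Proof. by apply: Lfun_sum => [|i _]; [exact: ltW|exact: Lfun_sqr_block_sum]. Qed.

Lemma adapted_sum_sqr : adapted n%:Z sum_sqr.
Proof.
move=> w w' ww'; apply: eq_big_nat => i /andP[_ ni]; congr (_ ^+ 2).
by apply: (adaptedW _ (@adapted_block_sum (l i) i)) ww'; rewrite lez_nat.
Qed.

Let w0 := (40 * (Delta ^+ 2 * L%:R)) `^ 2^-1.

Lemma nrm_mixB_sqr_block_sum i k : (1 <= i)%N -> (i <= n)%N ->
  nrm (m \x m)%E q (fun z => block_sum (l i) i (mix k z) ^+ 2 -
                            block_sum (l i) i (mix (k - 1) z) ^+ 2) <=
  2 * w0 * \sum_(0 <= s < L) zext delta (i%:Z - s%:Z - k).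
Proof.
move=> i1 i_n; set W := block_sum (l i) i.
have lW : W \in Lfun m alpha%:E by exact: Lfun_block_sum.
have lA := Lfun_mix im k alpha1 lW; have lB := Lfun_mix im (k - 1) alpha1 lW.
have lAB := LfunB alpha1 lA lB; have lAB' := LfunD alpha1 lA lB.
have D0 := Delta_ge0 sum_delta.
have Ww : nrm m alpha W <= w0.
  apply: (le_trans (nrm_block_sum (l i) i)).
  apply: ge0_ler_powR; rewrite ?nnegrE ?mulr_ge0 ?sqr_ge0// ?invr_ge0//.
  by rewrite ler_pM2l// ler_wpM2l ?sqr_ge0// ler_nat lL.
have n1 : nrm (m \x m)%E alpha (fun z => W (mix k z) + W (mix (k - 1) z)) <= 2 * w0.
  apply: (le_trans (nrmD alpha1 lA lB)); have mW := Lfun_measurable lW.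
  rewrite (nrm_mpres (mpres_mix im k) _ mW) (nrm_mpres (mpres_mix im (k - 1)) _ mW).
  by rewrite mulr_natl mulr2n lerD.
have n2 : nrm (m \x m)%E alpha (fun z => W (mix k z) - W (mix (k - 1) z)) <=
    \sum_(0 <= s < L) zext delta (i%:Z - s%:Z - k).
  apply: (le_trans (nrm_mixB_block_sum (l i) i k)).
  (* Lengthening the block to [L] adds only non-negative terms and makes the range independent of
     [i], so that the sums can be exchanged later. *)
  rewrite [leRHS](@big_cat_nat _ _ _ (l i))//=; last exact: lL.
  by rewrite lerDl sumr_ge0// => *; exact: zext_ge0.
rewrite (_ : (fun z => _) = (fun z => (W (mix k z) + W (mix (k - 1) z)) *
    (W (mix k z) - W (mix (k - 1) z)))); last by apply/funext => z; ring.
rewrite alphaE in lAB lAB' n1 n2.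
apply: (le_trans (nrm_mul (ltW q1) lAB' lAB).2).
by apply: ler_pM => //; exact: nrm_ge0.
Qed.

Lemma nrm_sum_sqr :
  nrm m q (fun w => sum_sqr w - \int[m]_y sum_sqr y) <=
  (20 * ((2 * w0 * (L%:R * Delta)) `^ q * n%:R)) `^ q^-1.
Proof.
have D0 := Delta_ge0 sum_delta.
have w00 : 0 <= w0 by exact: powR_ge0.
have q0 : 0 < q := lt_trans ltr01 q1.
have z0 := zext_ge0 delta0.
(* A bound for the norm of the difference at time [n - k], obtained by adding up the bounds for the
   single squares. *)
pose c (k : nat) := \sum_(1 <= i < n.+1) 2 * w0 *
  \sum_(0 <= s < L) zext delta (i%:Z - s%:Z - (n%:Z - k%:Z)).
have c0 k : 0 <= c k.
  by apply: sumr_ge0 => i _; rewrite !mulr_ge0// sumr_ge0.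
have cE k : c k = 2 * w0 * \sum_(0 <= s < L) \sum_(1 <= i < n.+1)
    zext delta (i%:Z - s%:Z - (n%:Z - k%:Z)).
  by rewrite /c -mulr_sumr exchange_big.
have cle k : c k <= 2 * w0 * (L%:R * Delta).
  rewrite cE ler_wpM2l ?mulr_ge0//.
  apply: (@le_trans _ _ (\sum_(0 <= s < L) Delta)).
    apply: ler_sum => s _; rewrite (eq_bigr (fun i : nat =>
      zext delta (i%:Z + (- s%:Z - (n%:Z - k%:Z))))); first exact: sum_zext_le.
    by move=> i _; rewrite addrA.
  by rewrite sumr_const_nat subn0 -[Delta *+ _]mulr_natl.
have csum K : \sum_(0 <= k < K) c k <= 2 * w0 * (L%:R * Delta) * n%:R.
  under eq_bigr do rewrite cE.
  rewrite -mulr_sumr -[leRHS]mulrA ler_wpM2l ?mulr_ge0// exchange_big/=.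
  apply: (@le_trans _ _ (\sum_(0 <= s < L) Delta * n%:R)).
    apply: ler_sum => s _; rewrite exchange_big/=.
    apply: (@le_trans _ _ (\sum_(1 <= i < n.+1) Delta)).
      apply: ler_sum => i _; rewrite (eq_bigr (fun k : nat =>
        zext delta (k%:Z + (i%:Z - s%:Z - n%:Z)))); first exact: sum_zext_le.
      by move=> k _; congr zext; clear; lia.
    by rewrite sumr_const_nat subSS subn0 -[Delta *+ _]mulr_natr.
  by rewrite sumr_const_nat subn0 -[_ *+ L]mulr_natl mulrA.
apply: (@moment_bound12 _ E R m im q n%:Z sum_sqr (fun k => c k `^ q) _ q1 q2
  Lfun_sum_sqr adapted_sum_sqr).
- move=> k.
  have lV := LfunB (ltW q1) (Lfun_mix im (n%:Z - k%:Z) (ltW q1) Lfun_sum_sqr)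
    (Lfun_mix im (n%:Z - k%:Z - 1) (ltW q1) Lfun_sum_sqr).
  rewrite (mom_nrm q0 lV).
  apply: ge0_ler_powR; rewrite ?nnegrE ?nrm_ge0//; first exact: ltW.
  rewrite (_ : (fun z => _) = (fun z => \sum_(1 <= i < n.+1)
      (block_sum (l i) i (mix (n%:Z - k%:Z) z) ^+ 2 -
       block_sum (l i) i (mix (n%:Z - k%:Z - 1) z) ^+ 2))); last first.
    by apply/funext => z; rewrite /sum_sqr sumrB.
  apply: (le_trans (nrm_sum _ (ltW q1) _)) => [i _|].
    by apply: (LfunB (ltW q1)); exact: (Lfun_mix im _ (ltW q1) (Lfun_sqr_block_sum (l i) i)).
  rewrite /c big_nat [leRHS]big_nat; apply: ler_sum => i /andP[i1 i_n].
  exact: nrm_mixB_sqr_block_sum.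
- move=> K; set A := 2 * w0 * (L%:R * Delta).
  have A0 : 0 <= A by rewrite !mulr_ge0.
  have q10 : 0 < q - 1 by rewrite subr_gt0.
  (* One factor [c k] is kept summable and the remaining power is bounded uniformly by [A^(q - 1)];
     the total is then at most [A^(q - 1) * (A * n)], however large [K] is. *)
  apply: (@le_trans _ _ (\sum_(0 <= k < K) A `^ (q - 1) * c k)).
    apply: ler_sum => k _; rewrite -(mulr_powRB1 (c0 k) q0) mulrC.
    rewrite ler_wpM2r//; apply: ge0_ler_powR; rewrite ?nnegrE//; exact: ltW.
  rewrite -mulr_sumr -(mulr_powRB1 A0 q0) (mulrC A) -mulrA ler_wpM2l ?powR_ge0//.
Qed.

End BlockSums.

(** * Block lengths and the rate *)

(** For [1 <= i] the candidate set contains 1 and is bounded by [i], so the maximum exists and the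
    specification does not rest on the default value of [xget]. *)
Lemma tseqP (a : nat -> nat) (i : nat) : (1 <= i)%N ->
  tset a i (tseq a i) /\ forall s, tset a i s -> (s <= tseq a i)%N.
Proof.
move=> i1; have bnd s : `[< tset a i s >] -> (s <= i)%N.
  by move=> /asboolP[->//|[k [_ [<-]]]].
have ex : exists s, `[< tset a i s >] by exists 1%N; apply/asboolP; left.
pose s0 := ex_maxn ex bnd.
have [/asboolP H1 H2] : `[< tset a i s0 >] /\ forall s, `[< tset a i s >] -> (s <= s0)%N.
  by rewrite /s0; case: ex_maxnP.
apply: (@xgetPex _ 1%N [set m | tset a i m /\ forall s, tset a i s -> (s <= m)%N]).
by exists s0; split => // s /asboolP; exact: H2.
Qed.

Lemma tseq_ge1 (a : nat -> nat) (i : nat) : (1 <= i)%N -> (1 <= tseq a i)%N.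
Proof. by move=> i1; apply: (tseqP a i1).2; left. Qed.

Lemma tseq_le (a : nat -> nat) (i : nat) : (1 <= i)%N -> (tseq a i <= i)%N.
Proof. by move=> i1; case: (tseqP a i1) => -[->//|[k [_ [<-]]]]. Qed.

Section BlockLength.
Context {R : realType} (c p : R).
Hypotheses (c0 : 0 < c) (p1 : 1 < p).

Lemma aseq_truncn k : aseq c p k = Num.truncn (c * k%:R `^ p).
Proof. by rewrite truncn_floor mulr_ge0 ?powR_ge0// ltW. Qed.

(** The summand [c] serves the indices before the first usable [a_k], and 2 pays for the floor in
    [aseq] and for counting both ends of a block. The last summand comes from the slope
    [c p y^(p - 1)] of [c y^p] at [y = (i / c)^(1/p)], where [i <= n]. *)
Definition block_const : R := c + 2 + c * p * c^-1 `^ (1 - p^-1).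

Lemma block_const_gt0 : 0 < block_const.
Proof.
have p0 : 0 < p := lt_trans ltr01 p1.
by rewrite /block_const ltr_wpDr ?mulr_ge0 ?powR_ge0 ?ltW// ltr_wpDr.
Qed.

(** With [y] solving [c y^p = i] and [k] its integer part, [a_k] is a candidate for the block start,
    so the block is hardly longer than [c (y^p - k^p)], and [y - k < 1]. *)
Lemma block_length_le (i n : nat) : (1 <= i)%N -> (i <= n)%N ->
  (i.+1 - tseq (aseq c p) i)%:R <= block_const * n%:R `^ (1 - p^-1).
Proof.
move=> i1 i_n; have p0 : 0 < p := lt_trans ltr01 p1.
have lam0 : 0 <= 1 - p^-1 by rewrite subr_ge0 invf_le1// ltW.
have n1 : 1 <= n%:R `^ (1 - p^-1) :> R.
  rewrite -[leLHS](powRr0 n%:R); apply: ler_powR => //.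
  by rewrite ler1n (leq_trans i1).
have i0 : 0 <= i%:R :> R by [].
set t := tseq _ i; have t1 : (1 <= t)%N by exact: tseq_ge1.
have ti : (t <= i)%N by exact: tseq_le.
rewrite natrB; last by rewrite leqW.
rewrite -natr1; set Q := n%:R `^ _ in n1 *.
set D := c * p * c^-1 `^ (1 - p^-1).
have D0 : 0 <= D by rewrite !mulr_ge0 ?powR_ge0 ?ltW.
have goalE : block_const * Q = c * Q + 2 * Q + D * Q by rewrite /block_const -/D !mulrDl.
have DQ0 : 0 <= D * Q by rewrite mulr_ge0// (le_trans _ n1).
have cQ : c <= c * Q by rewrite ler_peMr// ltW.
have tr1 : 1 <= t%:R :> R by rewrite ler1n.
pose y := (i%:R / c) `^ p^-1.
have y0 : 0 <= y by exact: powR_ge0.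
have ic0 : 0 <= i%:R / c by rewrite divr_ge0// ltW.
have yp : y `^ p = i%:R / c by rewrite /y -powRrM mulVf ?gt_eqF// powRr1.
pose k := Num.truncn y.
have /andP[ky yk] := truncn_itv y0.
rewrite -/k in ky yk.
rewrite goalE.
(* Block starts have index at least 1, so [k = 0] offers no candidate; in that case [i <= c], and
   the start 1 is good enough. *)
have [k0|k1] := posnP k.
  have ic : i%:R <= c.
    rewrite k0 in yk.
    have : y `^ p <= 1 `^ p.
      by apply: (ge0_ler_powR (ltW p0)); rewrite ?nnegrE// ltW.
    by rewrite yp powR1 ler_pdivrMr// mul1r.
  lra.
have ypos : 0 < y by apply: lt_le_trans ky; rewrite ltr0n.
have kp_le : k%:R `^ p <= i%:R / c.
  by rewrite -yp; apply: (ge0_ler_powR (ltW p0)); rewrite ?nnegrE.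
have ck_le : c * k%:R `^ p <= i%:R by rewrite mulrC -ler_pdivlMr.
have ck0 : 0 <= c * k%:R `^ p by rewrite mulr_ge0 ?powR_ge0// ltW.
have a_le : (aseq c p k <= i)%N.
  rewrite aseq_truncn -(ler_nat R); apply: le_trans ck_le.
  by rewrite truncn_le.
have t_ge : c * k%:R `^ p - 1 <= t%:R.
  have : (aseq c p k <= t)%N.
    by apply: (tseqP (aseq c p) i1).2; right; exists k.
  rewrite aseq_truncn -(ler_nat R); apply: le_trans.
  rewrite lerBlDr natr1; apply: ltW; exact: truncnS_gt.
(* By convexity [k^p] lies above the tangent of the power at [y]. *)
have kp_ge : y `^ p - p * y `^ (p - 1) <= k%:R `^ p.
  have z0 : 0 <= k%:R / y by rewrite divr_ge0.
  have -> : k%:R `^ p = y `^ p * (k%:R / y) `^ p.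
    by rewrite -powRM// mulrC divfK// gt_eqF.
  apply: le_trans (ler_wpM2l (powR_ge0 _ _) (powR_ge_tangent z0 (ltW p1))).
  rewrite -(mulr_powRB1 y0 p0).
  have -> : y * y `^ (p - 1) * (1 + p * (k%:R / y - 1)) =
      y * y `^ (p - 1) - p * y `^ (p - 1) * (y - k%:R) by field; rewrite gt_eqF.
  rewrite lerD2l lerN2 ler_piMr//; first by rewrite mulr_ge0 ?powR_ge0 ?(ltW p0).
  by rewrite lerBlDr addrC natr1 ltW.
have yp1 : y `^ (p - 1) <= Q * c^-1 `^ (1 - p^-1).
  rewrite /y -powRrM (_ : p^-1 * (p - 1) = 1 - p^-1); last by field; rewrite gt_eqF.
  have ci0 : 0 <= c^-1 by rewrite invr_ge0 ltW.
  rewrite /Q -powRM//.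
  apply: (ge0_ler_powR lam0); rewrite ?nnegrE ?mulr_ge0//.
  by rewrite ler_wpM2r// ler_nat.
have cE : c * y `^ p = i%:R by rewrite yp mulrC divfK// gt_eqF.
have main : i%:R - c * k%:R `^ p <= D * Q.
  have := ler_wpM2l (ltW c0) kp_ge; rewrite mulrBr cE => h1.
  have : c * (p * y `^ (p - 1)) <= D * Q.
    rewrite (_ : D * Q = c * (p * (Q * c^-1 `^ (1 - p^-1)))); last by rewrite /D; ring.
    by rewrite ler_pM2l// ler_pM2l.
  by move: h1; lra.
move: t_ge main cQ n1; move: (D * Q) (c * Q) (c * k%:R `^ p) => DQ CQ ck *.
by have := c0; lra.
Qed.

End BlockLength.

(** * Transfer of the process to path spaces *)

Section Law.
Context {d} {T : measurableType d} {R : realType} (P : probability T R).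
Context {dE} {E : measurableType dE}.

Lemma seq_law_exists (I : eqType) (Y : I -> T -> E) :
  (forall i, measurable_fun setT (Y i)) ->
  exists m : probability (seqspace I E) R, mpres P m (fun w i => Y i w).
Proof.
move=> mY.
have mF : measurable_fun setT ((fun w i => Y i w) : T -> seqspace I E).
  exact: measurable_to_seqspace.
pose F : {mfun T >-> seqspace I E} := HB.pack (fun w i => Y i w)
  (isMeasurableFun.Build _ _ _ _ _ mF).
by exists (distribution P F); split.
Qed.

Lemma mpres_coord (I : eqType) (Y : I -> T -> E) (m : probability (seqspace I E) R) i B :
  mpres P m (fun w i => Y i w) -> measurable B ->
  m ((fun w : seqspace I E => w i) @^-1` B) = P (Y i @^-1` B).
Proof.
move=> mp mB; symmetry; apply: mp.2.
by rewrite -[X in measurable X]setTI; exact: measurable_coord.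
Qed.

Lemma iid_indep_coord (I : eqType) (Y : I -> T -> E) (m : probability (seqspace I E) R) :
  mpres P m (fun w i => Y i w) ->
  (forall (J : seq I) (B : I -> set E), uniq J ->
     (forall j, j \in J -> measurable (B j)) ->
     P (\big[setI/setT]_(j <- J) (Y j @^-1` B j)) = (\prod_(j <- J) P (Y j @^-1` B j))%E) ->
  indep_coord m.
Proof.
move=> mp iY J B uJ mB.
transitivity (P (\big[setI/setT]_(j <- J) (Y j @^-1` B j))).
  rewrite -[LHS](mp.2 _ (measurable_cyl J mB)); congr (P _).
  rewrite cylE; elim: J {uJ} => [|j J IH]; first by rewrite !big_nil preimage_setT.
  by rewrite !big_cons preimage_setI IH.
by rewrite iY//; apply: eq_bigr => j _; rewrite (mpres_coord j mp).
Qed.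

End Law.

Section Process.
Context {d} {T : measurableType d} {R : realType} (P : probability T R).
Context {dE} {E : measurableType dE}.
Variables (eps : int -> T -> E) (eps0' : T -> E) (g : (nat -> E) -> R).

Definition coupled (o : option int) : T -> E :=
  match o with None => eps0' | Some i => eps i end.

Hypotheses (iid : iid_family P coupled) (mg : prod_measurable g).
Variables (m : probability (seqspace int E) R) (nu : probability (seqspace (option int) E) R).
Hypotheses (mp : mpres P m (fun w i => eps i w))
  (np : mpres P nu (fun w o => coupled o w)).

Lemma indep_eps : indep_coord m.
Proof.
apply: (iid_indep_coord mp) => J B uJ mB.
have [_ _ /(_ (map Some J) (fun o => if o is Some i then B i else setT))] := iid.
rewrite map_inj_uniq; last by move=> ? ? [].
rewrite !big_map; apply=> // _ /mapP[j jJ ->]; exact: mB.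
Qed.

Lemma indep_coupled : indep_coord nu.
Proof. by case: iid => _ _; exact: (iid_indep_coord np). Qed.

Definition causal (j : int) : seqspace int E -> R := fun w => g (fun k : nat => w (j - k%:Z)).

Lemma measurable_g d' (S : measurableType d') (f : S -> nat -> E) :
  (forall k, measurable_fun setT (fun x => f x k)) -> measurable_fun setT (fun x => g (f x)).
Proof.
move=> mf; have mg' : measurable_fun setT (g : seqspace nat E -> R).
  by move=> _ B mB; rewrite setTI; exact: mg.
have mf' : measurable_fun setT (f : S -> seqspace nat E) by exact: measurable_to_seqspace.
exact: (measurableT_comp mg' mf').
Qed.

Lemma measurable_causal j : measurable_fun setT (causal j).
Proof. by apply: measurable_g => k; exact: measurable_coord. Qed.

Lemma adapted_causal j : adapted j (causal j).
Proof.
by move=> w w' ww'; congr g; apply/funext => k; apply: ww'; clear; lia.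
Qed.

Definition coupling_gap (j : int) : seqspace (option int) E -> R := fun z =>
  g (fun k : nat => z (Some (j - k%:Z))) -
  g (fun k : nat => if j - k%:Z == 0 then z None else z (Some (j - k%:Z))).

Lemma measurable_coupling_gap j : measurable_fun setT (coupling_gap j).
Proof.
apply: measurable_funB; apply: measurable_g => k; first exact: measurable_coord.
by case: (j - k%:Z == 0); exact: measurable_coord.
Qed.

(* Coordinate [k] of the second copy plays the role of the resampled innovation. *)
Lemma mpres_coupling (k : int) :
  mpres (m \x m)%E nu (splice (fun o : option int => if o is Some i then i <= 0 else false)
    (fun o : option int => if o is Some i then i + k else k)).
Proof.
apply: mpres_splice; [exact: indep_eps|exact: indep_coupled| |].
  move=> o B mB; rewrite (mpres_coord _ np mB) (mpres_coord _ mp mB).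
  have [_ H _] := iid.
  exact: (H o (Some (if o is Some i then i + k else k)) B mB).
move=> [i|] [i'|] //; first by move=> _ ik; congr Some; move: ik; clear; lia.
  by move=> i0 ik; exfalso; move: i0 ik; clear; lia.
by move=> i0 ik; exfalso; move: i0 ik; clear; lia.
Qed.

Variable alpha : R.
Hypothesis alpha1 : 1 <= alpha.

Definition delta (j : nat) : R := fine (phys_dep P g eps eps0' alpha j).

(** Moving time by [k] brings the resampled innovation to time 0, and [mpres_coupling] identifies
    the joint law with that of the original innovations and [eps0']. For [j < k] causality makes the
    difference vanish. *)
Lemma nrm_mixB_causal j k : nrm (m \x m)%E alpha
    (fun z => causal j (mix k z) - causal j (mix (k - 1) z)) <= zext delta (j - k).
Proof.
have alpha0 : 0 < alpha := lt_le_trans ltr01 alpha1.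
rewrite /zext; case: ifP => jk; last first.
  rewrite (_ : (fun z => _) = fun=> 0) ?nrm0//; apply/funext => z.
  rewrite !(@adapted_mix _ _ _ _ (causal j)) ?subrr//;
    by apply: adaptedW (@adapted_causal j); move/negbT: jk; clear; lia.
rewrite /delta (_ : phys_dep _ _ _ _ _ _ = 'N[P]_alpha%:E
    [EFin \o (fun w => coupling_gap (j - k) (fun o => coupled o w))]%E); last first.
  by rewrite /phys_dep gez0_abs.
rewrite -/(nrm P alpha _) (nrm_mpres np alpha (measurable_coupling_gap (j - k))).
rewrite -(nrm_mpres (mpres_coupling k) alpha (measurable_coupling_gap (j - k))).
rewrite le_eqVlt; apply/orP; left; apply/eqP; congr nrm; apply/funext => z.
rewrite /coupling_gap /causal; congr (g _ - g _); apply/funext => i; rewrite /mix /splice.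
  rewrite (_ : j - k - i%:Z + k = j - i%:Z); last by clear; lia.
  by rewrite (_ : (j - k - i%:Z <= 0) = (j - i%:Z <= k))//; clear; lia.
rewrite (_ : j - k - i%:Z + k = j - i%:Z); last by clear; lia.
case: eqP => ji.
  have -> : j - i%:Z = k by move: ji; clear; lia.
  by rewrite (_ : (k <= k - 1) = false)//; clear; lia.
by rewrite (_ : (j - i%:Z <= k - 1) = (j - k - i%:Z <= 0))//; move: ji; clear; lia.
Qed.

Lemma delta_ge0 j : 0 <= delta j.
Proof. by rewrite /delta fine_ge0// Lnorm_ge0. Qed.

Lemma sum_delta_le K : (\sum_(0 <= j <oo) phys_dep P g eps eps0' alpha j < +oo)%E ->
  \sum_(0 <= j < K) delta j <= fine (\sum_(0 <= j <oo) phys_dep P g eps eps0' alpha j)%E.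
Proof.
move=> Soo; have ph0 j : (0 <= phys_dep P g eps eps0' alpha j)%E by exact: Lnorm_ge0.
have le N : (\sum_(0 <= j < N) phys_dep P g eps eps0' alpha j <=
    \sum_(0 <= j <oo) phys_dep P g eps eps0' alpha j)%E.
  exact: nneseries_lim_ge.
have fin j : phys_dep P g eps eps0' alpha j \is a fin_num.
  rewrite ge0_fin_numE//; apply: le_lt_trans Soo; apply: le_trans (le j.+1).
  by rewrite big_nat_recr//= leeDr// sume_ge0.
have S0 : (0 <= \sum_(0 <= j <oo) phys_dep P g eps eps0' alpha j)%E by exact: nneseries_ge0.
rewrite -lee_fin fineK; last by rewrite ge0_fin_numE.
apply: le_trans (le K); rewrite -sumEFin le_eqVlt; apply/orP; left; apply/eqP.
by apply: eq_bigr => j _; rewrite /delta fineK.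
Qed.

Lemma Vseq_sum_sqr (a : nat -> nat) (n : nat) w :
  Vseq g eps a n w = sum_sqr causal n (fun i => i.+1 - tseq a i)%N (fun i => eps i w).
Proof.
rewrite /Vseq /sum_sqr big_nat [RHS]big_nat; apply: eq_bigr => i /andP[i1 _].
rewrite /Wseq /block_sum; congr (_ ^+ 2); have ti := tseq_le a i1.
set t := tseq a i in ti *.
rewrite -{1}[t]add0n big_addn big_nat_rev/= big_nat [RHS]big_nat.
apply: eq_bigr => s /andP[_ sl]; rewrite /Xseq /causal.
rewrite (_ : (0 + (i.+1 - t) - s.+1 + t)%N%:Z = i%:Z - s%:Z)//.
by move: ti sl; clear; lia.
Qed.

End Process.

Section Rate.
Context {R : realType}.

(** With [lam = 1 - 1/p], the root of the block length gives [lam / 2], the length itself gives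
    [lam], and the factor [n] under the outer root gives [2 / alpha]; these add up to the exponent
    claimed. *)
Lemma rate_le (p alpha K D : R) (n L : nat) : 0 < alpha -> 1 < p -> 0 <= K -> 0 <= D ->
  (1 <= n)%N -> L%:R <= K * n%:R `^ (1 - p^-1) ->
  (20 * ((2 * (40 * (D ^+ 2 * L%:R)) `^ 2^-1 * (L%:R * D)) `^ (alpha / 2) * n%:R))
    `^ (alpha / 2)^-1 <=
  20 `^ (alpha / 2)^-1 * (2 * (40 * (D ^+ 2 * K)) `^ 2^-1 * (K * D)) *
    n%:R `^ (3 / 2 - 3 / (2 * p) + 2 / alpha).
Proof.
move=> a0 p1 K0 D0 n1 LK; have p0 : 0 < p := lt_trans ltr01 p1.
have x0 : 0 < n%:R :> R by rewrite ltr0n.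
set q := alpha / 2; have q0 : 0 < q by rewrite divr_gt0.
set x := n%:R in x0 LK *; set lam := 1 - p^-1 in LK *.
set w := (40 * (D ^+ 2 * L%:R)) `^ 2^-1; set w1 := (40 * (D ^+ 2 * K)) `^ 2^-1.
have w0 : 0 <= w by exact: powR_ge0.
have w10 : 0 <= w1 by exact: powR_ge0.
have D20 : 0 <= D ^+ 2 by exact: sqr_ge0.
have ww1 : w <= w1 * x `^ (lam / 2).
  rewrite /w1 (powRrM x lam 2^-1) -powRM ?powR_ge0//; last by rewrite !mulr_ge0.
  apply: ge0_ler_powR; rewrite ?nnegrE ?invr_ge0//.
  - by rewrite !mulr_ge0.
  - by rewrite !mulr_ge0 ?powR_ge0.
  - by rewrite -!mulrA !ler_wpM2l.
set A := 2 * w * (L%:R * D).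
have A0 : 0 <= A by rewrite !mulr_ge0.
have AE : A <= 2 * w1 * (K * D) * (x `^ (lam / 2) * x `^ lam).
  have -> : 2 * w1 * (K * D) * (x `^ (lam / 2) * x `^ lam) =
    2 * (w1 * x `^ (lam / 2)) * ((K * x `^ lam) * D) by ring.
  by apply: ler_pM; rewrite ?mulr_ge0 ?ler_pM2l ?ler_wpM2r.
clearbody A; rewrite !powRM ?mulr_ge0 ?powR_ge0 ?(ltW x0)//.
rewrite -powRrM mulfV ?gt_eqF// powRr1// -[leRHS]mulrA; apply: ler_wpM2l.
  exact: powR_ge0.
have -> : x `^ (3 / 2 - 3 / (2 * p) + 2 / alpha) = x `^ (lam / 2) * x `^ lam * x `^ q^-1.
  rewrite -!powRD ?(gt_eqF x0) ?implybT//; congr (_ `^ _).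
  by rewrite /lam /q; field; rewrite !gt_eqF.
by rewrite mulrA ler_wpM2r ?powR_ge0.
Qed.

End Rate.

Theorem theorem2 (R : realType) (d : measure_display) (T : measurableType d)
  (P : probability T R) (dE : measure_display) (E : measurableType dE)
  (eps : int -> T -> E) (eps0' : T -> E) (g : (nat -> E) -> R)
  (c p alpha : R) :
  0 < c -> 1 < p -> 2 < alpha -> alpha <= 4 ->
  iid_family P (fun o : option int =>
                  match o with None => eps0' | Some i => eps i end) ->
  prod_measurable g ->
  (forall i : int, ('E_P[Xseq g eps i] = 0)%E) ->
  (forall i : int, (Lnorm P alpha%:E (EFin \o Xseq g eps i) < +oo)%E) ->
  (\sum_(0 <= j <oo) phys_dep P g eps eps0' alpha j < +oo)%E ->
  exists C : R, exists N : nat, forall n : nat, (N <= n)%N ->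
    (Lnorm P (alpha / 2)%:E
       (EFin \o (fun w => (Vseq g eps (aseq c p) n w
                          - fine ('E_P[Vseq g eps (aseq c p) n])%E)%R))
     <= (C * (n%:R `^ (3/2 - 3/(2 * p) + 2/alpha)))%R%:E)%E.
Proof.
move=> c0 p1 a2 a4 iid mg EX LX SD.
have a0 : 0 < alpha := lt_trans (ltr0Sn R 1) a2.
have a1 : 1 <= alpha by apply: ltW; apply: lt_trans a2; rewrite ltr1n.
have mY o : measurable_fun setT (coupled eps eps0' o) by case: iid => + _ _; exact.
(* [nu] is the joint law of the innovations and [eps0'], [m] the law of the innovations alone; the
   copy [eps0'] enters only through the comparison of the differences with [delta]. *)
have [nu np] := seq_law_exists P mY.
have [m mp] := seq_law_exists P (fun i => mY (Some i)).
have im := indep_eps iid mp.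
have mX := measurable_causal mg.
have lX j : causal g j \in Lfun m alpha%:E.
  have mXj := mX j; rewrite inE; apply/andP; split; rewrite inE//=.
  by rewrite /finite_norm -(Lnorm_mpres mp _ (mX j)); exact: LX.
have X0 j : \int[m]_w causal g j w = 0.
  rewrite -(Rintegral_mpres mp (mX j)) /Rintegral.
  by have := EX j; rewrite unlock => ->.
have dX := nrm_mixB_causal iid mg mp np a1.
have d0 := delta_ge0 P eps eps0' g alpha.
have sD K := sum_delta_le (alpha := alpha) K SD.
set D := fine _ in sD.
pose l i := (i.+1 - tseq (aseq c p) i)%N.
pose K := block_const c p.
have K0 : 0 <= K by exact/ltW/block_const_gt0.
have D0 : 0 <= D := Delta_ge0 sD.
exists (20 `^ (alpha / 2)^-1 * (2 * (40 * (D ^+ 2 * K)) `^ 2^-1 * (K * D))), 1%N => n n1.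
(* Block lengths are integers, so the real bound on them may be rounded down. *)
pose L := Num.truncn (K * n%:R `^ (1 - p^-1)).
have LK : L%:R <= K * n%:R `^ (1 - p^-1) by rewrite truncn_le mulr_ge0 ?powR_ge0.
have lL i : (1 <= i)%N -> (i <= n)%N -> (l i <= L)%N.
  move=> i1 i_n; have := block_length_le c0 p1 i1 i_n; rewrite -/(l i) -/K => h.
  by have := le_truncn h; rewrite natrK.
have bound := nrm_sum_sqr im a2 a4 d0 sD lX (@adapted_causal _ _ _ g) X0 dX lL.
have lS := Lfun_sum_sqr a2 lX n l.
have mS := Lfun_measurable lS.
have VE : Vseq g eps (aseq c p) n = fun w => sum_sqr (causal g) n l (fun i => eps i w).
  by apply/funext => w; exact: Vseq_sum_sqr.
have q1 : 1 <= alpha / 2 by rewrite ler_pdivlMr// mul1r ltW.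
have lSc : (fun w => sum_sqr (causal g) n l w - \int[m]_y sum_sqr (causal g) n l y)
    \in Lfun m (alpha / 2)%:E by apply: (LfunB q1 lS); exact: Lfun_cst.
have -> : fine ('E_P[Vseq g eps (aseq c p) n])%E = \int[m]_y sum_sqr (causal g) n l y.
  by rewrite -(Rintegral_mpres mp mS) VE unlock.
rewrite VE (Lnorm_mpres mp _ (Lfun_measurable lSc)) -(nrmE lSc) lee_fin.
exact: le_trans bound (rate_le a0 p1 K0 D0 n1 LK).
Qed.
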